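(* For every integer $p \geqslant 4$, $$\gamma_4(K_p) = \left\lceil \frac{p(p-5)}{8} \right\rceil + 1,$$ where $K_p$ is the complete graph on $p$ vertices.
   Context: Given a 2-cell embedding of a graph in a surface, the length of a face is the number of edges on its boundary (counted with multiplicity along the boundary walk). For a graph $G$ and an integer $n \geqslant 3$, the $n$-genus $\gamma_n(G)$ is the minimum genus $h$ of a closed orientable surface $S_h$ in which $G$ has a 2-cell embedding in which every face has length at least $n$. Thus $\gamma_4(K_p)$ is the minimum genus of a closed orientable surface admitting a 2-cell embedding of $K_p$ with no faces of length less than $4$. *)

(* Defs.v *)
From mathcomp Require Import all_boot all_fingroup.

Set Implicit Arguments.
Unset Strict Implicit.
Unset Printing Implicit Defensive.

Record sgraph := SGraph {
  vertex :> finType;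
  adj : rel vertex;
  adj_sym : symmetric adj;
  adj_irrefl : irreflexive adj
}.

Lemma complete_adj_sym (p : nat) : symmetric (fun x y : 'I_p => x != y).
Proof. by move=> x y; rewrite eq_sym. Qed.

Lemma complete_adj_irrefl (p : nat) : irreflexive (fun x y : 'I_p => x != y).
Proof. by move=> x; rewrite eqxx. Qed.

Definition complete_graph (p : nat) : sgraph :=
  SGraph (@complete_adj_sym p) (@complete_adj_irrefl p).

Definition connected_graph (G : sgraph) : Prop :=
  0 < #|G| /\ forall x y : G, connect (@adj G) x y.

(* A dart is an edge together with a direction: (tail, head). *)
Definition dart (G : sgraph) := {d : G * G | adj d.1 d.2}.

Definition dart_tail (G : sgraph) (d : dart G) : G := (val d).1.
Definition dart_head (G : sgraph) (d : dart G) : G := (val d).2.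

Definition edges (G : sgraph) : {set {set G}} :=
  [set [set dart_tail d; dart_head d] | d : dart G].

Lemma dart_rev_subproof (G : sgraph) (d : dart G) :
  adj (dart_head d) (dart_tail d).
Proof. by rewrite adj_sym; exact: (valP d). Qed.

Definition dart_rev (G : sgraph) (d : dart G) : dart G :=
  exist (fun e : G * G => adj e.1 e.2) (dart_head d, dart_tail d)
    (dart_rev_subproof d).

Lemma dart_rev_inj (G : sgraph) : injective (@dart_rev G).
Proof.
move=> d1 d2 /(congr1 val) [eq_h eq_t]; apply: val_inj.
by rewrite [val d1]surjective_pairing [val d2]surjective_pairing; congr pair.
Qed.

Definition rev_perm (G : sgraph) : {perm dart G} := perm (@dart_rev_inj G).

(* 2-cell embeddings in closed oriented surfaces are represented by rotation
   systems (Heffter-Edmonds): at every vertex, a cyclic order of all the darts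
   leaving it. *)
Record embedding (G : sgraph) := Embedding {
  rotation : {perm dart G};
  rotationP : forall d : dart G,
    porbit rotation d = [set d' | dart_tail d' == dart_tail d]
}.

(* Boundary walks: after traversing d, leave the head of d along the dart that
   follows the reverse of d in the rotation there.  [(s * t) d] is [t (s d)]. *)
Definition face_perm (G : sgraph) (M : embedding G) : {perm dart G} :=
  (rev_perm G * rotation M)%g.

(* A face is the set of darts traversed by its boundary walk; as an edge that
   is traversed twice contributes both its darts, the length of the face is the
   cardinal of this set. *)
Definition faces (G : sgraph) (M : embedding G) : {set {set dart G}} :=
  porbits (face_perm M).

(* Euler's formula #V - #E + #F = 2 - 2h, without subtraction. *)
Definition has_genus (G : sgraph) (M : embedding G) (h : nat) : Prop :=
  #|G| + #|faces M| + h.*2 = #|edges G| + 2.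

(* The orientable surface of a rotation system is connected, with the above
   Euler characteristic, only if the graph is connected.  The one-vertex graph
   has no darts, so the length-0 face of its embedding in the sphere is not
   counted by [faces] and [has_genus] never holds; this embedding is of no
   relevance when all the faces must have a positive length. *)
Definition embeds_with_faces_ge (G : sgraph) (n h : nat) : Prop :=
  connected_graph G /\
  exists M : embedding G,
    has_genus M h /\ forall f, f \in faces M -> n <= #|f|.

Definition is_n_genus (n : nat) (G : sgraph) (h : nat) : Prop :=
  embeds_with_faces_ge G n h /\
  forall h' : nat, embeds_with_faces_ge G n h' -> h <= h'.

(* Main.v *)
(** Lower bound: if all faces have length at least 4 then [4 F <= 2 E], and
    Euler's formula gives [8 h >= p (p - 5) + 8].

    Upper bound: it suffices to embed K_p with quadrangular faces only, up to one
    or two longer faces whose total excess [2 E - 4 F] is less than 8.  Vertices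
    are grouped in pairs [c0 = 2i, c1 = 2i+1], and each pair is kept at opposite
    corners of some quadrangle [c0 s c1 t].  If two edge-disjoint embeddings have
    such faces [c0 s c1 t] and [c0 s' c1 t'] for the same pair, then splicing the
    rotations at [c0] and [c1] in these corners turns the two quadrangles into the
    two quadrangles [c0 s c1 t'] and [c0 s' c1 t]: embeddings can be superposed
    without creating any other face.  Superposing the old embedding, the complete
    bipartite graph between old and new pairs (the two vertices of a pair having
    opposite rotations) and K_8 leads from K_p to K_(p+8) for even p.

    For odd p there is one unpaired vertex, 0, and the last pair [z0, z1] has its
    quadrangle [z0 0 z1 t] at 0.  The new vertices are joined to 0, z0, z1 by a block
    embedding whose faces are quadrangles but for one octagon
    [z0 t' z1 p q 0 p' q'].  Splicing it into [z0 0 z1 t] at the three vertices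
    gives the quadrangles [z0 t' z1 t], [z0 0 p' q'] and [0 z1 p q].

    The block and the initial embeddings for p = 4, ..., 12 were found by computer
    search. *)

Require Import Defs.
From mathcomp Require Import all_boot all_order all_algebra all_fingroup.
From mathcomp Require Import zify lra.

Set Implicit Arguments.
Unset Strict Implicit.
Unset Printing Implicit Defensive.

(** * Splicing rotation systems at pairs of opposite vertices *)

(* [r v] lists the neighbours of [v] in rotation order.  Only the corners between
   consecutive entries of the list count: the corner between the last and the first
   entry is where another list can be spliced in. *)
Definition corner (r : nat -> seq nat) (v a b : nat) : bool :=
  infix [:: a; b] (r v).

(* The closed walk [u v w x] is a face; [L v a b] reads: the face entering [v] from
   [a] leaves it towards [b]. *)
Definition quad (L : nat -> nat -> nat -> bool) (u v w x : nat) : bool :=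
  [&& L v u w, L w v x, L x w u & L u x v].

(** Together with the turns from last entry to first at [i.*2] and [i.*2.+1], this closes the
    quadrangle through [i.*2], [s], [i.*2.+1], [t]. Its corners at the pair are those left open for
    splicing. *)
Definition opp (r : nat -> seq nat) (L : nat -> nat -> nat -> bool)
    (i s t : nat) : bool :=
  [&& prefix [:: s] (r i.*2), suffix [:: t] (r i.*2),
      prefix [:: t] (r i.*2.+1), suffix [:: s] (r i.*2.+1),
      L s i.*2 i.*2.+1 & L t i.*2.+1 i.*2].

Definition opp_darts (i s t : nat) : seq (nat * nat) :=
  [:: (i.*2, s); (s, i.*2.+1); (i.*2.+1, t); (t, i.*2)].

(** Empty lists are allowed, so that a map on some of the pairs can be superposed with a map on
    others. *)
Definition paired (P : nat -> bool) (r : nat -> seq nat)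
    (L : nat -> nat -> nat -> bool) : Prop :=
  forall i, P i ->
    (r i.*2 = [::] /\ r i.*2.+1 = [::]) \/ exists s t, opp r L i s t.

(* [X] collects the darts [(tail, head)] of the faces exempted from being
   quadrangles. *)
Definition quadrangular (P : nat -> bool) (r : nat -> seq nat)
    (L : nat -> nat -> nat -> bool) (X : seq (nat * nat)) : Prop :=
  forall u v, u \in r v ->
    [\/ (u, v) \in X, exists w x, quad L u v w x |
        exists i s t, [/\ P i, opp r L i s t & (u, v) \in opp_darts i s t]].

Lemma quad_rot L u v w x : quad L u v w x = quad L v w x u.
Proof. by rewrite /quad; do 3 case: (L _ _ _) => //=; rewrite ?andbT ?andbF. Qed.

Lemma quad_sub (L L' : nat -> nat -> nat -> bool) u v w x :
  (forall v a b, L v a b -> L' v a b) -> quad L u v w x -> quad L' u v w x.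
Proof. by move=> sL /and4P[? ? ? ?]; apply/and4P; split; apply: sL. Qed.

Lemma infix_junction (T : eqType) (s1 s2 : seq T) (a b : T) :
  suffix [:: a] s1 -> prefix [:: b] s2 -> infix [:: a; b] (s1 ++ s2).
Proof.
move=> /suffixP[p ->] /prefixP[q ->]; apply/infixP; exists p, q.
by rewrite -!catA.
Qed.

Lemma prefix1_uniq (T : eqType) (s : seq T) (a b : T) :
  prefix [:: a] s -> prefix [:: b] s -> a = b.
Proof. by move=> /prefixP[p ->] /prefixP[q [->]]. Qed.

Lemma suffix1_uniq (T : eqType) (s : seq T) (a b : T) :
  suffix [:: a] s -> suffix [:: b] s -> a = b.
Proof.
by move=> /suffixP[p ->] /suffixP[q] /eqP; rewrite !cats1 eqseq_rcons => /andP[_ /eqP].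
Qed.

Section Merge.

Variables (P : nat -> bool) (r1 r2 r : nat -> seq nat).
Variables (L1 L2 L : nat -> nat -> nat -> bool) (X1 X2 : seq (nat * nat)).
Hypothesis sub1 : forall v a b, L1 v a b -> L v a b.
Hypothesis sub2 : forall v a b, L2 v a b -> L v a b.
Hypothesis subr : forall v a b, corner r v a b -> L v a b.
Hypothesis rE : forall i, P i ->
  r i.*2 = r1 i.*2 ++ r2 i.*2 /\ r i.*2.+1 = r2 i.*2.+1 ++ r1 i.*2.+1.

(** The concatenation orders at the two vertices are opposite: one junction reads [t1], [s2], the
    other [s2], [t1], which closes a quadrangle. The outer ends leave the other one, on [s1] and
    [t2], open for the next splice. *)
Lemma opp_merge i s1 t1 s2 t2 : P i ->
  opp r1 L1 i s1 t1 -> opp r2 L2 i s2 t2 ->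
  opp r L i s1 t2 /\ quad L t1 i.*2 s2 i.*2.+1.
Proof.
move=> Pi /and5P[p1 q1 p1' q1' /andP[a1 b1]] /and5P[p2 q2 p2' q2' /andP[a2 b2]].
have [e0 e1] := rE Pi; split.
  apply/and5P; split; rewrite ?e0 ?e1 ?prefix_catl ?suffix_catr //.
  by rewrite sub1 ?sub2.
apply/and4P; split.
- by apply: subr; rewrite /corner e0 infix_junction.
- exact: sub2.
- by apply: subr; rewrite /corner e1 infix_junction.
- exact: sub1.
Qed.

Lemma opp_merge0r i s t : P i -> r2 i.*2 = [::] -> r2 i.*2.+1 = [::] ->
  opp r1 L1 i s t -> opp r L i s t.
Proof.
move=> Pi z0 z1 /and5P[? ? ? ? /andP[? ?]]; have [e0 e1] := rE Pi.
apply/and5P; split; rewrite ?e0 ?e1 ?z0 ?z1 ?cats0 //.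
by rewrite !sub1.
Qed.

Lemma opp_merge0l i s t : P i -> r1 i.*2 = [::] -> r1 i.*2.+1 = [::] ->
  opp r2 L2 i s t -> opp r L i s t.
Proof.
move=> Pi z0 z1 /and5P[? ? ? ? /andP[? ?]]; have [e0 e1] := rE Pi.
apply/and5P; split; rewrite ?e0 ?e1 ?z0 ?z1 ?cats0 //.
by rewrite !sub2.
Qed.

Hypotheses (pair1 : paired P r1 L1) (pair2 : paired P r2 L2).

Lemma paired_merge : paired P r L.
Proof.
move=> i Pi.
have [[z0 z1]|[s1 [t1 o1]]] := pair1 Pi; have [[z0' z1']|[s2 [t2 o2]]] := pair2 Pi.
- by left; have [-> ->] := rE Pi; rewrite z0 z1 z0' z1'.
- by right; exists s2, t2; apply: opp_merge0l.
- by right; exists s1, t1; apply: opp_merge0r.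
- by right; exists s1, t2; have [] := opp_merge Pi o1 o2.
Qed.

Hypothesis mem_r : forall u v, u \in r v -> u \in r1 v \/ u \in r2 v.
Hypotheses (quad1 : quadrangular P r1 L1 X1) (quad2 : quadrangular P r2 L2 X2).

(** Only the open quadrangles change: two darts of each go to the closed quadrangle of [opp_merge],
    the other two to the open one. Outside [P] it is enough that corners survive, which leaves room
    for a different splice at vertex 0 in the odd case. *)
Lemma quadrangular_merge : quadrangular P r L (X1 ++ X2).
Proof.
move=> u v /mem_r[ru|ru].
  have [|[w [x q]]|[i [s1 [t1 [Pi o1 du]]]]] := quad1 ru.
  - by move=> Xu; constructor 1; rewrite mem_cat Xu.
  - by constructor 2; exists w, x; apply: quad_sub q.
  have [[z0 z1]|[s2 [t2 o2]]] := pair2 Pi.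
    by constructor 3; exists i, s1, t1; split=> //; apply: opp_merge0r.
  have [o q] := opp_merge Pi o1 o2; move: du; rewrite !inE.
  case/or4P=> /eqP[-> ->].
  - by constructor 3; exists i, s1, t2; rewrite o !inE eqxx.
  - by constructor 3; exists i, s1, t2; rewrite o !inE eqxx !orbT.
  - by constructor 2; exists i.*2, s2; rewrite quad_rot.
  - by constructor 2; exists s2, i.*2.+1.
have [|[w [x q]]|[i [s2 [t2 [Pi o2 du]]]]] := quad2 ru.
- by move=> Xu; constructor 1; rewrite mem_cat Xu orbT.
- by constructor 2; exists w, x; apply: quad_sub q.
have [[z0 z1]|[s1 [t1 o1]]] := pair1 Pi.
  by constructor 3; exists i, s2, t2; split=> //; apply: opp_merge0l.
have [o q] := opp_merge Pi o1 o2; move: du; rewrite !inE.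
case/or4P=> /eqP[-> ->].
- by constructor 2; exists i.*2.+1, t1; rewrite -quad_rot.
- by constructor 2; exists t1, i.*2; rewrite -2!quad_rot.
- by constructor 3; exists i, s1, t2; rewrite o !inE eqxx !orbT.
- by constructor 3; exists i, s1, t2; rewrite o !inE eqxx !orbT.
Qed.

End Merge.

(** * Complete bipartite graphs *)

(** With the odd label first, even vertices turn from [i.*2.+1] to [i.*2] and odd ones, with the
    reversed list, back. These are the turns that [opp] asks for at [t] and at [s], as the list
    starts with an odd [s] and ends with an even [t]. *)
Definition pair_seq (a k : nat) : seq nat :=
  flatten [seq [:: i.*2.+1; i.*2] | i <- iota a k].

Lemma pair_seqD a k l : pair_seq a (k + l) = pair_seq a k ++ pair_seq (a + k) l.
Proof. by rewrite /pair_seq iotaD map_cat flatten_cat. Qed.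

Lemma pair_seqS a k : pair_seq a k.+1 = [:: a.*2.+1, a.*2 & pair_seq a.+1 k].
Proof. by []. Qed.

Lemma mem_pair_seq a k v : (v \in pair_seq a k) = (a <= v./2 < a + k).
Proof.
elim: k a => [|k IH] a; first by rewrite /pair_seq /= in_nil; lia.
by rewrite pair_seqS !inE IH; lia.
Qed.

Lemma uniq_pair_seq a k : uniq (pair_seq a k).
Proof.
elim: k a => [|k IH] a //; rewrite pair_seqS !cons_uniq IH !inE !mem_pair_seq.
by lia.
Qed.

Lemma infix_pair_seq a k i : a <= i < a + k ->
  infix [:: i.*2.+1; i.*2] (pair_seq a k).
Proof.
move=> ai; have -> : k = (i - a) + (a + k - i).-1.+1 by lia.
rewrite pair_seqD infix_catl // subnKC ?pair_seqS; last by lia.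
exact: (prefix_infix [:: _; _]).
Qed.

Lemma infix_pair_seq_next a k i : a <= i -> i.+1 < a + k ->
  infix [:: i.*2; i.+1.*2.+1] (pair_seq a k).
Proof.
move=> ai ik; have -> : k = (i - a) + (a + k - i).-2.+2 by lia.
rewrite pair_seqD infix_catl // subnKC ?pair_seqS //.
exact: (infix_infix [:: _] [:: _; _]).
Qed.

Lemma infix_pair_seq_prev a k i : a < i < a + k ->
  infix [:: i.-1.*2; i.*2.+1] (pair_seq a k).
Proof. by case: i => // i /andP[ai ik]; apply: infix_pair_seq_next. Qed.

Lemma prefix_pair_seq a k : 0 < k -> prefix [:: a.*2.+1] (pair_seq a k).
Proof. by case: k => // k _; rewrite pair_seqS /= eqxx. Qed.

Lemma suffix_pair_seq a k : 0 < k -> suffix [:: (a + k).-1.*2] (pair_seq a k).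
Proof.
case: k => // k _; rewrite -[k.+1]addn1 pair_seqD suffix_catr //.
by rewrite addnA addn1 pair_seqS; apply: (suffix_suffix [:: _]).
Qed.

Section Bipartite.

Variables (r : nat -> seq nat) (a k b l : nat).
Hypotheses (k0 : 0 < k) (l0 : 0 < l).
Hypothesis rA : forall i, a <= i < a + k ->
  r i.*2 = pair_seq b l /\ r i.*2.+1 = rev (pair_seq b l).
Hypothesis rB : forall i, b <= i < b + l ->
  r i.*2 = pair_seq a k /\ r i.*2.+1 = rev (pair_seq a k).

Lemma opp_bipartite i : a <= i < a + k ->
  opp r (corner r) i b.*2.+1 (b + l).-1.*2.
Proof.
move=> Ai; have [e0 e1] := rA Ai.
have [_ f1] := rB (i := b) ltac:(lia).
have [g0 _] := rB (i := (b + l).-1) ltac:(lia).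
apply/and5P; split; rewrite ?e0 ?e1.
- exact: prefix_pair_seq.
- exact: suffix_pair_seq.
- by rewrite -suffix_revLR suffix_pair_seq.
- by rewrite -prefix_revLR prefix_pair_seq.
- by rewrite /corner f1 g0 -infix_revLR !infix_pair_seq.
Qed.

End Bipartite.

Section BipartiteDarts.

Variables (r : nat -> seq nat) (a k b l : nat).
Hypotheses (k0 : 0 < k) (l0 : 0 < l).
Hypothesis rA : forall i, a <= i < a + k ->
  r i.*2 = pair_seq b l /\ r i.*2.+1 = rev (pair_seq b l).
Hypothesis rB : forall i, b <= i < b + l ->
  r i.*2 = pair_seq a k /\ r i.*2.+1 = rev (pair_seq a k).

(** For each choice of parities, the face contains both vertices of one pair and one vertex from
    each of two successive pairs on the other side. If there is no such successive pair, the dart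
    lies on an open quadrangle. *)
Lemma bipartite_darts u v : a <= u./2 < a + k -> b <= v./2 < b + l ->
  (exists w x, quad (corner r) u v w x) \/
  exists i s t, opp r (corner r) i s t /\ (u, v) \in opp_darts i s t.
Proof.
move=> Au Bv; have [i [eu Ai]] : exists i, u = odd u + i.*2 /\ a <= i < a + k.
  by exists u./2; rewrite odd_double_half.
have [j [ev Bj]] : exists i, v = odd v + i.*2 /\ b <= i < b + l.
  by exists v./2; rewrite odd_double_half.
have [A0 A1] := rA Ai; have [B0 B1] := rB Bj.
have oA := opp_bipartite k0 l0 rA rB Ai.
have oB := opp_bipartite l0 k0 rB rA Bj.
rewrite eu ev; case: (odd u); case: (odd v); rewrite ?add0n ?add1n.
- have [ia|ia] := eqVneq i a.
    right; exists j, a.*2.+1, (a + k).-1.*2; split=> //.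
    by rewrite ia !inE eqxx ?orbT.
  left; exists i.-1.*2, j.*2; have [C0 C1] := rA (i := i.-1) ltac:(lia).
  apply/and4P; split.
  + rewrite /corner B1 -infix_revLR infix_pair_seq_prev //; lia.
  + by rewrite /corner C0 infix_pair_seq.
  + rewrite /corner B0 infix_pair_seq_prev //; lia.
  + by rewrite /corner A1 -infix_revLR infix_pair_seq.
- have [ja|ja] := eqVneq j (b + l).-1.
    right; exists i, b.*2.+1, (b + l).-1.*2; split=> //.
    by rewrite ja !inE eqxx ?orbT.
  left; exists i.*2, j.+1.*2.+1; have [C0 C1] := rB (i := j.+1) ltac:(lia).
  apply/and4P; split.
  + by rewrite /corner B0 infix_pair_seq.
  + by rewrite /corner A0 infix_pair_seq_next //; lia.
  + by rewrite /corner C1 -infix_revLR infix_pair_seq.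
  + by rewrite /corner A1 -infix_revLR infix_pair_seq_next //; lia.
- have [ja|ja] := eqVneq j b.
    right; exists i, b.*2.+1, (b + l).-1.*2; split=> //.
    by rewrite ja !inE eqxx ?orbT.
  left; exists i.*2.+1, j.-1.*2; have [C0 C1] := rB (i := j.-1) ltac:(lia).
  apply/and4P; split.
  + by rewrite /corner B1 -infix_revLR infix_pair_seq.
  + rewrite /corner A1 -infix_revLR infix_pair_seq_prev //; lia.
  + by rewrite /corner C0 infix_pair_seq.
  + rewrite /corner A0 infix_pair_seq_prev //; lia.
- have [ia|ia] := eqVneq i (a + k).-1.
    right; exists j, a.*2.+1, (a + k).-1.*2; split=> //.
    by rewrite ia !inE eqxx ?orbT.
  left; exists i.+1.*2.+1, j.*2.+1; have [C0 C1] := rA (i := i.+1) ltac:(lia).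
  apply/and4P; split.
  + by rewrite /corner B0 infix_pair_seq_next //; lia.
  + by rewrite /corner C1 -infix_revLR infix_pair_seq.
  + by rewrite /corner B1 -infix_revLR infix_pair_seq_next //; lia.
  + by rewrite /corner A0 infix_pair_seq.
Qed.

End BipartiteDarts.

Definition bipartite (a k b l v : nat) : seq nat :=
  let s := if a <= v./2 < a + k then pair_seq b l
           else if b <= v./2 < b + l then pair_seq a k else [::] in
  if odd v then rev s else s.

Lemma mem_bipartite a k b l u v :
  (u \in bipartite a k b l v) =
  (if a <= v./2 < a + k then b <= u./2 < b + l
   else (b <= v./2 < b + l) && (a <= u./2 < a + k)).
Proof.
rewrite /bipartite; case: odd; case: ifP => _; rewrite ?mem_rev ?mem_pair_seq //.
  by case: ifP => _; rewrite ?mem_rev ?mem_pair_seq.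
by case: ifP => _; rewrite ?mem_pair_seq.
Qed.

Lemma uniq_bipartite a k b l v : uniq (bipartite a k b l v).
Proof.
rewrite /bipartite; case: odd; rewrite ?rev_uniq.
  by case: ifP => _; [|case: ifP => _]; rewrite ?uniq_pair_seq.
by case: ifP => _; [|case: ifP => _]; rewrite ?uniq_pair_seq.
Qed.

Section BipartiteMap.

Variables a k b l : nat.
Hypotheses (k0 : 0 < k) (l0 : 0 < l) (ab : a + k <= b).

Let rA i : a <= i < a + k ->
  bipartite a k b l i.*2 = pair_seq b l /\
  bipartite a k b l i.*2.+1 = rev (pair_seq b l).
Proof. by move=> Ai; rewrite /bipartite /= odd_double uphalf_double doubleK Ai. Qed.

Let rB i : b <= i < b + l ->
  bipartite a k b l i.*2 = pair_seq a k /\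
  bipartite a k b l i.*2.+1 = rev (pair_seq a k).
Proof.
move=> Bi; rewrite /bipartite /= odd_double uphalf_double doubleK Bi.
by case: ifP => //; lia.
Qed.

Lemma paired_bipartite :
  paired xpredT (bipartite a k b l) (corner (bipartite a k b l)).
Proof.
move=> i _.
have [Ai|nA] := boolP (a <= i < a + k).
  by right; exists b.*2.+1, (b + l).-1.*2; apply: (opp_bipartite _ _ rA rB).
have [Bi|nB] := boolP (b <= i < b + l).
  by right; exists a.*2.+1, (a + k).-1.*2; apply: (opp_bipartite _ _ rB rA).
left; rewrite /bipartite /= odd_double uphalf_double doubleK.
by rewrite (negbTE nA) (negbTE nB).
Qed.

Lemma quadrangular_bipartite :
  quadrangular xpredT (bipartite a k b l) (corner (bipartite a k b l)) [::].
Proof.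
move=> u v; rewrite mem_bipartite => H.
suff [q|[i [s [t [o d]]]]] :
  (exists w x, quad (corner (bipartite a k b l)) u v w x) \/
  exists i s t, opp (bipartite a k b l) (corner (bipartite a k b l)) i s t /\
    (u, v) \in opp_darts i s t.
- by constructor 2.
- by constructor 3; exists i, s, t.
move: H; case: ifP => [Av Bu|_ /andP[Bv Au]].
  exact: (bipartite_darts l0 k0 rB rA).
exact: (bipartite_darts k0 l0 rA rB).
Qed.

End BipartiteMap.

(** * Even order *)

(** The order depends on parity so that the two vertices of a pair are concatenated oppositely, as
    [opp_merge] requires. *)
Definition join (r1 r2 : nat -> seq nat) (v : nat) : seq nat :=
  if odd v then r2 v ++ r1 v else r1 v ++ r2 v.

Lemma mem_join r1 r2 u v :
  (u \in join r1 r2 v) = (u \in r1 v) || (u \in r2 v).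
Proof. by rewrite /join; case: odd; rewrite mem_cat // orbC. Qed.

Lemma uniq_join r1 r2 v : uniq (r1 v) -> uniq (r2 v) ->
  (forall u, u \in r1 v -> u \notin r2 v) -> uniq (join r1 r2 v).
Proof.
move=> u1 u2 dis; suff u12 : uniq (r1 v ++ r2 v).
  by rewrite /join; case: odd; rewrite // uniq_catC.
by rewrite cat_uniq u1 u2 andbT; apply/hasPn => u; apply: contraL => /dis.
Qed.

Lemma joinE r1 r2 i : join r1 r2 i.*2 = r1 i.*2 ++ r2 i.*2 /\
  join r1 r2 i.*2.+1 = r2 i.*2.+1 ++ r1 i.*2.+1.
Proof. by rewrite /join /= odd_double. Qed.

Lemma corner_joinl r1 r2 v a b : corner r1 v a b -> corner (join r1 r2) v a b.
Proof. by rewrite /corner /join; case: odd => c; [apply: infix_catl | apply: infix_catr]. Qed.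

Lemma corner_joinr r1 r2 v a b : corner r2 v a b -> corner (join r1 r2) v a b.
Proof. by rewrite /corner /join; case: odd => c; [apply: infix_catr | apply: infix_catl]. Qed.

Lemma paired_join P r1 r2 :
  paired P r1 (corner r1) -> paired P r2 (corner r2) ->
  paired P (join r1 r2) (corner (join r1 r2)).
Proof.
apply: paired_merge => //; first exact: corner_joinl; first exact: corner_joinr.
by move=> i _; apply: joinE.
Qed.

Lemma quadrangular_join P r1 r2 X1 X2 :
  paired P r1 (corner r1) -> paired P r2 (corner r2) ->
  quadrangular P r1 (corner r1) X1 -> quadrangular P r2 (corner r2) X2 ->
  quadrangular P (join r1 r2) (corner (join r1 r2)) (X1 ++ X2).
Proof.
move=> p1 p2 q1 q2; apply: (quadrangular_merge _ _ _ _ p1 p2 _ q1 q2) => //;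
  first exact: corner_joinl; first exact: corner_joinr.
  by move=> i _; apply: joinE.
by move=> u v; rewrite mem_join => /orP.
Qed.

Section Shift.

Variables (b m : nat) (r : nat -> seq nat).

(** With [b = 0] the whole map moves past the old pairs; with [b = 1] the unpaired vertex 0 stays in
    place and the rest moves. *)
Definition shiftv (v : nat) : nat := if v < b.*2 then v else v + m.*2.

Definition shift (v : nat) : seq nat :=
  if v < b.*2 then map shiftv (r v)
  else if v < (b + m).*2 then [::] else map shiftv (r (v - m.*2)).

Lemma shiftv_inj : injective shiftv.
Proof. by move=> u v; rewrite /shiftv; case: ifP; case: ifP; lia. Qed.

Lemma shiftE v : shift (shiftv v) = map shiftv (r v).
Proof.
rewrite /shift /shiftv; have [vb|bv] := ltnP v b.*2; first by rewrite vb.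
by rewrite ifN ?ifN ?addnK //; lia.
Qed.

Lemma shiftv_surj v : shift v != [::] -> exists v', v = shiftv v'.
Proof.
rewrite /shift; case: ifP => [vb _|nb]; first by exists v; rewrite /shiftv vb.
case: ifP => // nm _; exists (v - m.*2); rewrite /shiftv ifN; last by lia.
by rewrite subnK //; lia.
Qed.

Lemma mem_shift u v :
  u \in shift v -> exists u' v', [/\ u = shiftv u', v = shiftv v' & u' \in r v'].
Proof.
move=> us; have [v' ev] : exists v', v = shiftv v'.
  by apply: shiftv_surj; apply/eqP => e; rewrite e in us.
by move: us; rewrite ev shiftE => /mapP[u' ru' ->]; exists u', v'.
Qed.

Lemma uniq_shift v : (forall w, uniq (r w)) -> uniq (shift v).
Proof.
move=> ur; rewrite /shift; case: ifP => _; rewrite ?map_inj_uniq //.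
  exact: shiftv_inj.
by case: ifP => _; rewrite ?map_inj_uniq //; apply: shiftv_inj.
Qed.

Lemma corner_shift v x y :
  corner r v x y -> corner shift (shiftv v) (shiftv x) (shiftv y).
Proof.
rewrite /corner shiftE => /infixP[p [q ->]]; rewrite !map_cat /=.
exact: infix_infix.
Qed.

Lemma quad_shift u v w x : quad (corner r) u v w x ->
  quad (corner shift) (shiftv u) (shiftv v) (shiftv w) (shiftv x).
Proof. by case/and4P=> *; apply/and4P; split; apply: corner_shift. Qed.

Definition shiftp (i : nat) : nat := if i < b then i else i + m.

Lemma shiftv_double i : shiftv i.*2 = (shiftp i).*2.
Proof. by rewrite /shiftv /shiftp; do 2 case: ifP; lia. Qed.

Lemma shiftv_doubleS i : shiftv i.*2.+1 = (shiftp i).*2.+1.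
Proof. by rewrite /shiftv /shiftp; do 2 case: ifP; lia. Qed.

Lemma opp_shift i s t : opp r (corner r) i s t ->
  opp shift (corner shift) (shiftp i) (shiftv s) (shiftv t).
Proof.
have pre x z : prefix [:: x] (r z) -> prefix [:: shiftv x] (shift (shiftv z)).
  by rewrite shiftE => /prefixP[q ->]; apply: (prefix_prefix [:: _]).
have suf x z : suffix [:: x] (r z) -> suffix [:: shiftv x] (shift (shiftv z)).
  by rewrite shiftE => /suffixP[q ->]; rewrite map_cat; apply: suffix_suffix.
case/and5P=> p0 q0 p1 q1 /andP[c0 c1].
rewrite /opp -shiftv_doubleS -shiftv_double.
by rewrite !pre ?suf ?corner_shift.
Qed.

Variables (P P' : nat -> bool).
Hypothesis PE : forall j, P' (shiftp j) = P j.

Lemma paired_shift : paired P r (corner r) -> paired P' shift (corner shift).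
Proof.
move=> pr i Pi; have [gap|ngap] := boolP (b <= i < b + m).
  left; rewrite /shift; split; (rewrite ifN; last by lia); rewrite ifT //; lia.
have [j ej] : exists j, i = shiftp j.
  exists (if i < b then i else i - m); rewrite /shiftp.
  by do 2 case: ifP; lia.
move: Pi; rewrite ej PE => /pr[[z0 z1]|[s [t o]]].
  by left; rewrite -shiftv_doubleS -shiftv_double !shiftE z0 z1.
by right; exists (shiftv s), (shiftv t); apply: opp_shift.
Qed.

Lemma quadrangular_shift X : quadrangular P r (corner r) X ->
  quadrangular P' shift (corner shift) [seq (shiftv d.1, shiftv d.2) | d <- X].
Proof.
move=> qr u v /mem_shift[u' [v' [-> -> /qr[Xu|[w [x q]]|[i [s [t [Pi o d]]]]]]]].
- by constructor 1; apply/mapP; exists (u', v').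
- by constructor 2; exists (shiftv w), (shiftv x); apply: quad_shift.
- constructor 3; exists (shiftp i), (shiftv s), (shiftv t).
  rewrite PE; split=> //; first exact: opp_shift.
  move: d; rewrite !inE -shiftv_doubleS -shiftv_double.
  by case/or4P=> /eqP[-> ->]; rewrite eqxx ?orbT.
Qed.

End Shift.

(** * Maps given by tables and checked by computation *)

Section Table.

Variable tab : seq (seq nat).
Let r := nth [::] tab.

Definition check_vertices (e : rel nat) : bool :=
  all (fun v => perm_eq (r v) [seq u <- iota 0 (size tab) | e u v])
      (iota 0 (size tab)).

Lemma mem_table e u v : check_vertices e ->
  (u \in r v) = [&& u < size tab, v < size tab & e u v].
Proof.
move/allP=> ok; have [vn|nv] := ltnP v (size tab); last first.
  by rewrite /r nth_default //= andbF.
rewrite (perm_mem (ok v _)) ?mem_iota //.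
by rewrite mem_filter mem_iota /= add0n andbC.
Qed.

Lemma uniq_table e v : check_vertices e -> uniq (r v).
Proof.
move/allP=> ok; have [vn|nv] := ltnP v (size tab); last by rewrite /r nth_default.
by rewrite (perm_uniq (ok v _)) ?filter_uniq ?iota_uniq // mem_iota.
Qed.

Variables (P : nat -> bool) (L : nat -> nat -> nat -> bool).

Let sof i := head 0 (r i.*2).
Let tof i := last 0 (r i.*2).

Definition check_pairs : bool :=
  all (fun i => P i ==> opp r L i (sof i) (tof i)) (iota 0 (size tab)./2).

Lemma paired_table : ~~ odd (size tab) -> check_pairs -> paired P r L.
Proof.
move=> ev /allP ok i Pi; have [ni|ni] := ltnP i (size tab)./2.
  right; exists (sof i), (tof i); have := ok i; rewrite mem_iota Pi.
  exact.
by left; rewrite /r !nth_default //; lia.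
Qed.

(** [next] turns cyclically and only proposes the two remaining vertices of the face; [quad L]
    rejects proposals that use a corner outside [L]. *)
Definition check_darts (X : seq (nat * nat)) : bool :=
  all (fun v => all (fun u =>
    [|| (u, v) \in X,
        let w := next (r v) u in quad L u v w (next (r w) v) |
        has (fun i => P i && ((u, v) \in opp_darts i (sof i) (tof i)))
            (iota 0 (size tab)./2)]) (r v)) (iota 0 (size tab)).

Lemma quadrangular_table X : check_pairs -> check_darts X -> quadrangular P r L X.
Proof.
move=> /allP okp /allP ok u v ruv.
have vn : v < size tab by rewrite ltnNge; apply/negP => nv; rewrite /r nth_default in ruv.
have /allP/(_ u ruv)/or3P[Xu|q|/hasP[i ip /andP[Pi d]]] := ok v ltac:(by rewrite mem_iota).
- by constructor 1.
- by constructor 2; exists (next (r v) u), (next (r (next (r v) u)) v).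
- constructor 3; exists i, (sof i), (tof i); split=> //.
  by have := okp i ip; rewrite Pi.
Qed.

End Table.

(** The exempt faces use inner corners only, never the turn from the end of a list to its start, so
    that splicing leaves them intact. *)
Definition traces (r : nat -> seq nat) (Es : seq (seq (nat * nat))) : bool :=
  all (path.cycle (fun d d' : nat * nat => (d.2 == d'.1) && corner r d.2 d.1 d'.2)) Es.

Lemma traces_sub r r' Es : (forall v a b, corner r v a b -> corner r' v a b) ->
  traces r Es -> traces r' Es.
Proof.
move=> sub; apply: sub_all => E; case: E => // d E; apply: sub_path => x y /=.
by case/andP=> -> /sub ->.
Qed.

Definition even_state (h : nat) (Es : seq (seq (nat * nat))) (r : nat -> seq nat) :=
  [/\ forall v, uniq (r v),
      forall u v, (u \in r v) = [&& u < h.*2, v < h.*2 & u != v],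
      paired xpredT r (corner r),
      quadrangular xpredT r (corner r) (flatten Es) &
      traces r Es].

Definition table8 : seq (seq nat) :=
  [:: [:: 2; 3; 1; 4; 6; 5; 7];
      [:: 7; 3; 6; 4; 5; 0; 2];
      [:: 0; 1; 3; 6; 7; 5; 4];
      [:: 4; 1; 5; 6; 7; 2; 0];
      [:: 1; 0; 5; 7; 6; 3; 2];
      [:: 2; 0; 3; 7; 6; 4; 1];
      [:: 2; 7; 5; 3; 0; 1; 4];
      [:: 4; 6; 3; 5; 1; 0; 2]].

Definition check_even (tab : seq (seq nat)) (Es : seq (seq (nat * nat))) : bool :=
  let L := corner (nth [::] tab) in
  [&& ~~ odd (size tab), check_vertices tab (fun u v => u != v),
      check_pairs tab xpredT L, check_darts tab xpredT L (flatten Es) &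
      traces (nth [::] tab) Es].

Lemma even_state_table tab Es :
  check_even tab Es -> even_state (size tab)./2 Es (nth [::] tab).
Proof.
case/and5P=> ev okv okp okd okt; split=> //.
- by move=> v; apply: uniq_table okv.
- move=> u v; rewrite (mem_table _ _ okv).
  by rewrite (_ : (size tab)./2.*2 = size tab); last by lia.
- exact: paired_table.
- exact: quadrangular_table.
Qed.

Lemma even_state8 : even_state 4 [::] (nth [::] table8).
Proof. by apply: (even_state_table (tab := table8)); vm_compute. Qed.

Lemma even_state_step h Es r : 0 < h ->
  even_state h Es r -> exists r', even_state (h + 4) Es r'.
Proof.
move=> h0 [ur mr pr qr tr]; have [u8 m8 p8 q8 _] := even_state8.
pose k8 := shift 0 h (nth [::] table8).
pose main := bipartite 0 h h 4.
have mk8 u v : (u \in k8 v) = [&& h.*2 <= u < (h + 4).*2, h.*2 <= v < (h + 4).*2 & u != v].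
  apply/idP/idP => [/mem_shift[u' [v' [-> ->]]]|uv].
    by rewrite m8 /shiftv !ltn0; lia.
  have -> : v = shiftv 0 h (v - h.*2) by rewrite /shiftv ltn0; lia.
  rewrite /k8 shiftE; have -> : u = shiftv 0 h (u - h.*2) by rewrite /shiftv ltn0; lia.
  by rewrite map_f // m8; lia.
have mm u v : (u \in main v) =
    (v < h.*2) && (h.*2 <= u < (h + 4).*2) || (u < h.*2) && (h.*2 <= v < (h + 4).*2).
  by rewrite mem_bipartite; case: ifP => H; apply/idP/idP; lia.
exists (join k8 (join r main)); split.
- move=> v; apply: uniq_join; first exact: uniq_shift.
    apply: uniq_join => //; first exact: uniq_bipartite.
    by move=> u; rewrite mr mm; lia.
  by move=> u; rewrite mem_join mk8 mr mm; lia.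
- by move=> u v; rewrite !mem_join mk8 mr mm; lia.
- apply: paired_join; first exact: (paired_shift (P := xpredT)).
  by apply: paired_join => //; apply: paired_bipartite.
- apply: (@quadrangular_join _ _ _ [::] (flatten Es)); first exact: (paired_shift (P := xpredT)).
  + by apply: paired_join => //; apply: paired_bipartite.
  + exact: (@quadrangular_shift _ _ _ xpredT _ _ [::]).
  + rewrite -[X in quadrangular _ _ _ X]cats0.
    by apply: quadrangular_join => //; [apply: paired_bipartite | apply: quadrangular_bipartite].
- by apply: traces_sub tr => v a b c; apply/corner_joinr/corner_joinl.
Qed.

(** * Odd order *)

Lemma infix2_cat (T : eqType) (a b : T) (s1 s2 : seq T) :
  infix [:: a; b] (s1 ++ s2) ->
  [\/ infix [:: a; b] s1, infix [:: a; b] s2 |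
      suffix [:: a] s1 && prefix [:: b] s2].
Proof.
elim: s1 => [|c s1 IH]; first by constructor 2.
rewrite cat_cons infix_consl => /orP[/=/andP[/eqP -> p]|/IH[i1|i2|/andP[sa pb]]].
- case: s1 p {IH} => [|d s1] /=.
    by move=> p; constructor 3; rewrite suffix_refl.
  case/andP=> /eqP -> _; constructor 1.
  exact: (prefix_infix [:: _; _]).
- by constructor 1; rewrite infix_consl i1 orbT.
- by constructor 2.
- by constructor 3; rewrite pb andbT; apply: (suffix_catr [:: c]).
Qed.

Lemma suffix_no_infix (T : eqType) (a b : T) (s : seq T) :
  uniq s -> suffix [:: a] s -> ~~ infix [:: a; b] s.
Proof.
move=> us /suffixP[p e]; move: us; rewrite {}e => us; apply/negP.
case/infixP=> [q [q' /= e]].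
have ap : a \notin p by move: us; rewrite cats1 rcons_uniq => /andP[].
have iq : a \notin q.
  move: us; rewrite e -cat_rcons cat_uniq rcons_uniq => /andP[/andP[]] //.
have := congr1 (index a) e; rewrite !index_cat (negbTE ap) (negbTE iq) /= !eqxx !addn0.
have := congr1 size e; rewrite !size_cat /=; lia.
Qed.

(* At the unpaired vertex 0 the corner between the last and the first entry of the
   list is closed as well. *)
Definition ccorner (r : nat -> seq nat) (v a b : nat) : bool :=
  corner r v a b || [&& v == 0, suffix [:: a] (r 0) & prefix [:: b] (r 0)].

Lemma cornerW r v a b : corner r v a b -> ccorner r v a b.
Proof. by rewrite /ccorner => ->. Qed.

(* The vertices are all the numbers below [2 h] but 1, the missing partner of 0. *)
Definition odd_state (h : nat) (Es : seq (seq (nat * nat))) (r : nat -> seq nat) :=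
  [/\ [/\ forall v, uniq (r v),
      forall u v, (u \in r v) = [&& u < h.*2, v < h.*2, u != v, u != 1 & v != 1] &
      traces r Es],
      paired (leq 1) r (ccorner r),
      quadrangular (leq 1) r (ccorner r) (flatten Es) &
      [/\ exists t, opp r (ccorner r) h.-1 0 t,
      prefix [:: h.-1.*2.+1] (r 0) & suffix [:: h.-1.*2] (r 0)]].

(** * Opening the corner at 0 between the vertices of the last pair *)

Section Reopen.

Variables (z t : nat) (r : nat -> seq nat) (X : seq (nat * nat)).
Hypotheses (z0 : 0 < z) (ur : forall v, uniq (r v)).
Hypotheses (oz : opp r (ccorner r) z 0 t).
Hypotheses (pz : prefix [:: z.*2.+1] (r 0)) (sz : suffix [:: z.*2] (r 0)).

Let P i := (0 < i) && (i != z).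

(** The closing corner at 0 starts from the last entry [z.*2] of [r 0], so it can serve no pair but
    [z]. *)
Lemma reopen_opp i s' t' : i != z -> opp r (ccorner r) i s' t' ->
  opp r (corner r) i s' t'.
Proof.
rewrite /opp => iz /and5P[-> -> -> -> /andP[c0 c1]] /=.
have nw x y : x != z.*2 -> ccorner r y x =1 corner r y x.
  move=> xz b; rewrite /ccorner; case: and3P => [[_ sx _]|_]; rewrite ?orbF //.
  by rewrite (suffix1_uniq sx sz) eqxx in xz.
by rewrite -!nw ?c0 ?c1 //; lia.
Qed.

(** A walk turning through the closing corner at 0 continues to [z.*2.+1], whose list ends with 0.
    No inner corner leads on from there, so the walk is not a [quad]. *)
Lemma reopen_corner u v w x : quad (ccorner r) u v w x -> corner r v u w.
Proof.
case/and4P=> /orP[//|/and3P[/eqP v0 su pw]] c _ _.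
have wz := prefix1_uniq pw pz; move: c; rewrite v0 wz /ccorner orbF => c.
have /and5P[_ _ _ s0 _] := oz.
by have := suffix_no_infix x (ur _) s0; rewrite -/(corner r _ _ _) c.
Qed.

Lemma paired_reopen : paired (leq 1) r (ccorner r) -> paired P r (corner r).
Proof.
move=> pr i /andP[i0 iz]; have [|[s' [t' o]]] := pr i i0; first by left.
by right; exists s', t'; apply: reopen_opp.
Qed.

(** Only the quadrangle of the pair [z] uses the opened corner, so its four darts become exempt. *)
Lemma quadrangular_reopen : quadrangular (leq 1) r (ccorner r) X ->
  quadrangular P r (corner r) (X ++ opp_darts z 0 t).
Proof.
move=> qr u v /qr[Xu|[w [x q]]|[i [s' [t' [i0 o d]]]]].
- by constructor 1; rewrite mem_cat Xu.
- constructor 2; exists w, x; apply/and4P.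
  have q1 := q; rewrite quad_rot in q1; have q2 := q1; rewrite quad_rot in q2.
  have q3 := q2; rewrite quad_rot in q3.
  by split; [apply: (reopen_corner q) | apply: (reopen_corner q1) |
             apply: (reopen_corner q2) | apply: (reopen_corner q3)].
- have [iz|iz] := eqVneq i z.
    move: o d; rewrite iz => /and5P[ps st _ _ _].
    have /and5P[ps' st' _ _ _] := oz.
    rewrite (prefix1_uniq ps ps') (suffix1_uniq st st') => d.
    by constructor 1; rewrite mem_cat d orbT.
  constructor 3; exists i, s', t'; split=> //; first by rewrite /P iz andbT.
  exact: reopen_opp.
Qed.

End Reopen.

Definition block : seq (seq nat) :=
  [:: [:: 5; 9; 4; 8; 10; 11; 7; 6];
      [::];
      [:: 6; 11; 5; 8; 9; 10; 4; 7];
      [:: 5; 7; 4; 11; 8; 10; 9; 6];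
      [:: 10; 8; 9; 7; 6; 3; 2; 5; 0; 11];
      [:: 11; 3; 6; 0; 7; 9; 2; 8; 4; 10];
      [:: 9; 5; 0; 8; 10; 2; 3; 7; 11; 4];
      [:: 4; 5; 2; 3; 11; 10; 8; 0; 6; 9];
      [:: 2; 9; 0; 5; 11; 4; 6; 7; 3; 10];
      [:: 10; 8; 5; 4; 11; 0; 6; 7; 3; 2];
      [:: 0; 9; 8; 11; 6; 4; 5; 2; 3; 7];
      [:: 7; 5; 4; 9; 8; 2; 10; 3; 6; 0]].

(* With [z0 = 2], [z1 = 3] this is the octagon [z0 6 z1 5 6 0 5 7]; the new vertices
   are [4, ..., 11]. *)
Definition block_face : seq (nat * nat) :=
  [:: (2, 6); (6, 3); (3, 5); (5, 6); (6, 0); (0, 5); (5, 7); (7, 2)].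

(** 0, 2 and 3 stand for old vertices, already joined by the old map; hence every edge of the block
    has a new end. *)
Definition block_adj (u v : nat) : bool :=
  [&& u != v, u != 1, v != 1 & (3 < u) || (3 < v)].

Lemma block_vertices : check_vertices block block_adj.
Proof. by vm_compute. Qed.

(** The pair of 2 and 3 is left out because its list ends meet in the octagon, not in a
    quadrangle. *)
Lemma block_pairs : check_pairs block (leq 2) (corner (nth [::] block)).
Proof. by vm_compute. Qed.

Lemma block_darts :
  check_darts block (leq 2) (corner (nth [::] block)) block_face.
Proof. by vm_compute. Qed.

(** * Adding eight vertices to a map of odd order *)

Section OddStep.

Variables (h t : nat) (r : nat -> seq nat) (Es : seq (seq (nat * nat))).
Hypothesis h3 : 2 < h.
Hypothesis ur : forall v, uniq (r v).
Hypothesis mr : forall u v,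
  (u \in r v) = [&& u < h.*2, v < h.*2, u != v, u != 1 & v != 1].
Hypothesis tr : traces r Es.
Hypothesis pr : paired (leq 1) r (ccorner r).
Hypothesis qr : quadrangular (leq 1) r (ccorner r) (flatten Es).
Let z := h.-1.
Hypothesis oz : opp r (ccorner r) z 0 t.
Hypotheses (pz : prefix [:: z.*2.+1] (r 0)) (sz : suffix [:: z.*2] (r 0)).

Let P i := (0 < i) && (i != z).
Let f := shiftv 1 (h - 2).
Let blk := shift 1 (h - 2) (nth [::] block).
Let main := bipartite 1 (h - 2) h 4.
Let old := join r main.
Let D1 := [seq f v | v <- [:: 5; 9; 4; 8; 10]].
Let D2 := [seq f v | v <- [:: 11; 7; 6]].
(** The block has the list [D1 ++ D2] at 0. The old list enters at its octagon corner, from 6 to 5,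
    and the new list is cut between 10 and 11, the last new pair, where the next step will
    splice. *)
Let r' v := if v == 0 then D2 ++ r 0 ++ D1 else join blk old v.

Let z0 : 0 < z. Proof. by rewrite /z; lia. Qed.

Let fE v : 2 <= v -> f v = v + (h - 2).*2.
Proof. by move=> v2; rewrite /f /shiftv ifN //; lia. Qed.

Let blkE v : blk (f v) = map f (nth [::] block v).
Proof. exact: shiftE. Qed.

Let blk0 : blk 0 = D1 ++ D2.
Proof. exact: (blkE 0). Qed.

Let fz0 : f 2 = z.*2. Proof. by rewrite fE // /z; lia. Qed.
Let fz1 : f 3 = z.*2.+1. Proof. by rewrite fE // /z; lia. Qed.

Let mem_blk u v : (u \in blk v) =
  [&& u != v, (u == 0) || (z.*2 <= u < (h + 4).*2),
      (v == 0) || (z.*2 <= v < (h + 4).*2) & (h.*2 <= u) || (h.*2 <= v)].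
Proof.
have mb := mem_table _ _ block_vertices.
apply/idP/idP => [/mem_shift[u' [v' [-> ->]]]|uv].
  rewrite mb /block_adj /= /shiftv /z; do 2 case: ifP; lia.
have fK x : (x == 0) || (z.*2 <= x < (h + 4).*2) ->
    x = f (if x == 0 then 0 else x - (h - 2).*2).
  case: eqP => [-> //|_ /= H]; rewrite fE; move: H; rewrite /z; lia.
have /and4P[_ hu hv _] := uv.
rewrite (fK v hv) blkE (fK u hu) map_f // mb /block_adj /=.
by move: uv; rewrite /z; case: (u =P 0); case: (v =P 0); lia.
Qed.

Let mem_main u v : (u \in main v) =
  (2 <= v < z.*2) && (h.*2 <= u < (h + 4).*2) ||
  (2 <= u < z.*2) && (h.*2 <= v < (h + 4).*2).
Proof.
by rewrite mem_bipartite /z; case: ifP => H; apply/idP/idP; lia.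
Qed.

Let main0 : main 0 = [::].
Proof. by rewrite /main /bipartite /=; case: ifP => //; lia. Qed.

Let mainz : main z.*2 = [::] /\ main z.*2.+1 = [::].
Proof.
by rewrite /main /bipartite /= odd_double uphalf_double doubleK /z; do 2 (rewrite ifN; last by lia).
Qed.

Let r'E i : 0 < i ->
  r' i.*2 = blk i.*2 ++ old i.*2 /\ r' i.*2.+1 = old i.*2.+1 ++ blk i.*2.+1.
Proof. by move=> i0; rewrite /r' double_eq0 (gtn_eqF i0) /=; apply: joinE. Qed.

Let r'0 : r' 0 = D2 ++ r 0 ++ D1. Proof. by []. Qed.

Let mem_r' u v : (u \in r' v) = (u \in blk v) || (u \in old v).
Proof.
rewrite /r'; case: eqP => [->|_]; last by rewrite mem_join.
by rewrite /old mem_join main0 blk0 !mem_cat in_nil orbF; do 3 case: (_ \in _).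
Qed.

Let uniq_r' v : uniq (r' v).
Proof.
rewrite /r'; case: eqP => [_|_].
  rewrite uniq_catC -catA -blk0 cat_uniq ur uniq_shift; last first.
    by move=> w; apply: uniq_table block_vertices.
  by rewrite andbT; apply/hasPn => u; rewrite mem_blk mr /z; lia.
apply: uniq_join; first by apply: uniq_shift => w; apply: uniq_table block_vertices.
  apply: uniq_join => //; first exact: uniq_bipartite.
  by move=> u; rewrite mr mem_main /z; lia.
by move=> u; rewrite /old mem_join mem_blk mr mem_main /z; lia.
Qed.

Let mem_r'E u v : (u \in r' v) =
  [&& u < (h + 4).*2, v < (h + 4).*2, u != v, u != 1 & v != 1].
Proof. by rewrite mem_r' /old mem_join mem_blk mr mem_main /z; lia. Qed.

Let mainP : paired P main (corner main).
Proof.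
have pm := @paired_bipartite 1 (h - 2) h 4 ltac:(lia) ltac:(lia) ltac:(lia).
by move=> i _; apply: pm.
Qed.

Let mainQ : quadrangular P main (corner main) [::].
Proof.
have qm := @quadrangular_bipartite 1 (h - 2) h 4 ltac:(lia) ltac:(lia) ltac:(lia).
move=> u v /qm[//|q|[i [s [t' [_ o d]]]]]; first by constructor 2.
constructor 3; exists i, s, t'; split=> //.
(* A pair with an open quadrangle has nonempty lists, while [main] is empty at 0 and at [z.*2];
   hence [i] satisfies [P]. *)
have /and5P[/prefixP[q e] _ _ _ _] := o.
rewrite /P lt0n; apply/andP; split; apply/eqP => ei; rewrite -/main ei in e.
  by rewrite main0 in e.
by have [z00 _] := mainz; rewrite z00 in e.
Qed.

Let shiftP j : P (shiftp 1 (h - 2) j) = (1 < j).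
Proof. by rewrite /P /shiftp /z; case: ifP; lia. Qed.

Let y := (h + 4).-1.

Let Py : P y. Proof. by rewrite /P /y /z; lia. Qed.

Let shiftp_y : shiftp 1 (h - 2) 5 = y.
Proof. by rewrite /shiftp /y /=; lia. Qed.

Let mem_main_y : 2 \in main y.*2.
Proof. by rewrite mem_main /y /z; lia. Qed.

Let corner_r v a b : corner r v a b -> corner r' v a b.
Proof.
rewrite /corner /r'; case: eqP => [->|_] c; last by apply/corner_joinr/corner_joinl.
by apply/infix_catl/infix_catr.
Qed.

Let corner_old v a b : corner old v a b -> ccorner r' v a b.
Proof.
move=> c; apply: cornerW; rewrite /corner /r'; case: eqP => [v0|_].
  move: c; rewrite v0 /corner /old /join main0 cats0 => c.
  exact/infix_catl/infix_catr.
exact: corner_joinr.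
Qed.

Let prefix0 : prefix [:: (h + 4).-1.*2.+1] (r' 0).
Proof.
have -> : (h + 4).-1.*2.+1 = f 11 by rewrite fE //; lia.
exact: (prefix_prefix [:: _]).
Qed.

Let suffix0 : suffix [:: (h + 4).-1.*2] (r' 0).
Proof.
have -> : (h + 4).-1.*2 = f 10 by rewrite fE //; lia.
by rewrite r'0 !suffix_catr // /D1 (map_rcons f [:: 5; 9; 4; 8] 10) -cats1 suffix_suffix.
Qed.

Let corner_blk v a b : corner blk v a b -> ccorner r' v a b.
Proof.
move=> c; case: (v =P 0) => [v0|/eqP v0]; last first.
  by apply: cornerW; rewrite /corner /r' (negbTE v0); apply: corner_joinl.
move: c; rewrite v0 /corner blk0 => /infix2_cat[c|c|/andP[sa pb]].
- by apply: cornerW; rewrite /corner r'0 !infix_catl.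
- by apply: cornerW; rewrite /corner r'0 infix_catr.
(* The junction of [D1] and [D2] is now the turn from the last entry of [r' 0] to the first, which
   [ccorner] admits. *)
- apply/orP; right; apply/and3P; split=> //.
  by rewrite r'0 !suffix_catr.
Qed.

Let oldP : paired P old (corner old).
Proof.
by apply: paired_join => //; apply: (paired_reopen (t := t)).
Qed.

Let oldQ : quadrangular P old (corner old) (flatten Es ++ opp_darts z 0 t).
Proof.
rewrite -[X in quadrangular _ _ _ X]cats0; apply: quadrangular_join => //.
- exact: (paired_reopen (t := t)).
- exact: quadrangular_reopen.
Qed.

Let blkP : paired P blk (corner blk).
Proof. by apply: paired_shift shiftP _; apply: paired_table block_pairs. Qed.

Let blkQ : quadrangular P blk (corner blk) [seq (f d.1, f d.2) | d <- block_face].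
Proof.
by apply: quadrangular_shift shiftP _ _; apply: quadrangular_table block_darts; apply: block_pairs.
Qed.

Let subr' v a b : corner r' v a b -> ccorner r' v a b.
Proof. exact: cornerW. Qed.

Let r'EP i : P i ->
  r' i.*2 = blk i.*2 ++ old i.*2 /\ r' i.*2.+1 = old i.*2.+1 ++ blk i.*2.+1.
Proof. by case/andP=> i0 _; apply: r'E. Qed.

Let r'P : paired P r' (ccorner r').
Proof. exact: (paired_merge corner_blk corner_old subr' r'EP blkP oldP). Qed.

Let r'Q : quadrangular P r' (ccorner r')
  ([seq (f d.1, f d.2) | d <- block_face] ++ flatten Es ++ opp_darts z 0 t).
Proof.
apply: (quadrangular_merge corner_blk corner_old subr' r'EP blkP oldP _ blkQ oldQ).
by move=> u v; rewrite mem_r' => /orP.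
Qed.

Let blk_corner v a b : corner (nth [::] block) v a b -> ccorner r' (f v) (f a) (f b).
Proof. by move=> c; apply/corner_blk/corner_shift. Qed.

Let old_z0 : old z.*2 = r z.*2.
Proof. by have [e _] := joinE r main z; rewrite /old e; have [-> _] := mainz; rewrite cats0. Qed.

Let old_z1 : old z.*2.+1 = r z.*2.+1.
Proof. by have [_ e] := joinE r main z; rewrite /old e; have [_ ->] := mainz. Qed.

Let blk_pre v a : prefix [:: a] (nth [::] block v) -> prefix [:: f a] (blk (f v)).
Proof. by rewrite blkE => /prefixP[q ->]; apply: (prefix_prefix [:: _]). Qed.

Let blk_suf v a : suffix [:: a] (nth [::] block v) -> suffix [:: f a] (blk (f v)).
Proof. by rewrite blkE => /suffixP[q ->]; rewrite map_cat; apply: suffix_suffix. Qed.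

(** First of the three quadrangles made from the octagon and the old quadrangle at [z]; it stays
    open. *)
Let oppz : opp r' (ccorner r') z (f 6) t.
Proof.
have /and5P[pz0 sz0 pz1 sz1 /andP[cz ct]] := oz.
have [e0 e1] := r'E z0; apply/and5P; split; rewrite ?e0 ?e1 ?old_z0 ?old_z1.
- by rewrite -fz0 prefix_catl // blk_pre.
- exact: suffix_catr.
- exact: prefix_catl.
- by rewrite -fz1 suffix_catr // blk_suf.
- rewrite -fz1 -fz0 blk_corner //= fz0 fz1 cornerW // corner_r //.
  move: ct; rewrite /ccorner => /orP[//|/and3P[_ sx _]].
  by have /(congr1 odd) := suffix1_uniq sx sz; rewrite /= odd_double.
Qed.

(** Closed by the junction of [r 0] with [D1] at 0 and that of the block list with the old list at
    [z.*2]. *)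
Let quad1 : quad (ccorner r') z.*2 0 (f 5) (f 7).
Proof.
have /and5P[pz0 sz0 pz1 sz1 _] := oz; have [e0 e1] := r'E z0.
apply/and4P; split.
- by apply: cornerW; rewrite /corner r'0 infix_catl // infix_junction //= eqxx.
- exact: (@blk_corner 5 0 7).
- by rewrite -fz0; apply: (@blk_corner 7 5 2).
- apply: cornerW; rewrite /corner e0 old_z0 infix_junction //.
  by rewrite -fz0 blk_suf.
Qed.

(** Closed by the junction of [D2] with [r 0] at 0 and that of the old list with the block list at
    [z.*2.+1]. *)
Let quad2 : quad (ccorner r') 0 z.*2.+1 (f 5) (f 6).
Proof.
have /and5P[pz0 sz0 pz1 sz1 _] := oz; have [e0 e1] := r'E z0.
apply/and4P; split.
- apply: cornerW; rewrite /corner e1 old_z1 infix_junction //.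
  by rewrite -fz1 blk_pre.
- by rewrite -fz1; apply: (@blk_corner 5 3 6).
- exact: (@blk_corner 6 5 0).
- apply: cornerW; rewrite /corner r'0 infix_junction ?prefix_catl //.
  by rewrite /D2 (map_rcons f [:: 11; 7] 6) -cats1 suffix_suffix.
Qed.

(** The eight darts of the octagon and the four of the old quadrangle are redistributed over the
    three quadrangles above. *)
Let special_or_quad u v :
  (u, v) \in [seq (f d.1, f d.2) | d <- block_face] ++ opp_darts z 0 t ->
  (exists w x, quad (ccorner r') u v w x) \/ (u, v) \in opp_darts z (f 6) t.
Proof.
have f0 : f 0 = 0 by [].
have q1 := quad1; have q2 := q1; rewrite quad_rot in q2.
have q3 := q2; rewrite quad_rot in q3; have q4 := q3; rewrite quad_rot in q4.
have p1 := quad2; have p2 := p1; rewrite quad_rot in p2.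
have p3 := p2; rewrite quad_rot in p3; have p4 := p3; rewrite quad_rot in p4.
rewrite mem_cat => /orP[/mapP[d]|].
{ rewrite /block_face => d8 [-> ->]; move: d8.
  repeat match goal with |- is_true (_ \in _ :: _) -> _ =>
    rewrite in_cons => /predU1P[->|] end; last by rewrite in_nil.
  all: rewrite /= ?f0 ?fz0 ?fz1.
  all: try by left; eexists; eexists; eassumption.
  all: by right; rewrite /opp_darts !in_cons ?eqxx ?orbT. }
rewrite {1}/opp_darts !in_cons in_nil orbF.
case/or4P=> /eqP[-> ->].
- by left; eexists; eexists; eassumption.
- by left; eexists; eexists; eassumption.
- by right; rewrite !eqxx ?orbT.
- by right; rewrite !eqxx ?orbT.
Qed.

Lemma odd_step : odd_state (h + 4) Es r'.
Proof.
split; [split | | | split=> //].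
- exact: uniq_r'.
- exact: mem_r'E.
- exact: traces_sub tr.
- move=> i i0; have [->|iz] := eqVneq i z; first by right; exists (f 6), t.
  by apply: r'P; rewrite /P i0.
- move=> u v /r'Q[|q|[i [s [t' [/andP[i0 _] o d]]]]].
  + rewrite !mem_cat orbCA => /orP[Eu|]; first by constructor 1.
    rewrite -mem_cat => /special_or_quad[q|d]; first by constructor 2.
    by constructor 3; exists z, (f 6), t.
  + by constructor 2.
  + by constructor 3; exists i, s, t'.
(* The last block pair, 10 and 11, has its quadrangle at 0 and 7. Merging keeps the end 0 because
   the block is the first map in the splice, and [main] makes the old lists at [y] nonempty. *)
- have oy : opp blk (corner blk) y 0 (f 7).
    have := @opp_shift 1 (h - 2) (nth [::] block) 5 0 7 isT.
    by rewrite shiftp_y.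
  have [[e _]|[s2 [t2 o2]]] := oldP Py.
    have := mem_main_y; have := mem_join r main 2 y.*2.
    by rewrite -/old e => /esym/norP[_ /negbTE ->].
  by exists t2; have [] := opp_merge corner_blk corner_old subr' r'EP Py oy o2.
Qed.

End OddStep.

Lemma odd_state_step h Es r : 2 < h ->
  odd_state h Es r -> exists r', odd_state (h + 4) Es r'.
Proof.
move=> h3 [[ur mr tr] pr qr [[t oz] pz sz]].
by eexists; apply: odd_step ur mr tr pr qr oz pz sz.
Qed.

Definition check_odd (tab : seq (seq nat)) (Es : seq (seq (nat * nat))) : bool :=
  let r := nth [::] tab in let L := ccorner r in let h := (size tab)./2 in
  [&& [&& ~~ odd (size tab),
          check_vertices tab (fun u v => [&& u != v, u != 1 & v != 1]) &
          traces r Es],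
      check_pairs tab (leq 1) L, check_darts tab (leq 1) L (flatten Es),
      opp r L h.-1 0 (last 0 (r h.-1.*2)) &
      prefix [:: h.-1.*2.+1] (r 0) && suffix [:: h.-1.*2] (r 0)].

Lemma odd_state_table tab Es :
  check_odd tab Es -> odd_state (size tab)./2 Es (nth [::] tab).
Proof.
case/and5P=> /and3P[ev okv okt] okp okd oz /andP[pz sz]; split; [split| | |split] => //.
- by move=> v; apply: uniq_table okv.
- move=> u v; rewrite (mem_table _ _ okv).
  by rewrite (_ : (size tab)./2.*2 = size tab); last by lia.
- exact: paired_table.
- exact: quadrangular_table.
- by exists (last 0 (nth [::] tab (size tab)./2.-1.*2)).
Qed.

(** * From rotation lists to embeddings *)

Lemma partition_porbits (T : finType) (s : {perm T}) :
  partition (porbits s) [set: T].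
Proof.
apply/and3P; split.
- apply/eqP/setP => x; rewrite inE; apply/bigcupP.
  by exists (porbit s x); rewrite ?porbit_id ?imset_f.
- apply/trivIsetP => _ _ /imsetP[x _ ->] /imsetP[y _ ->] ne.
  rewrite -setI_eq0; apply/eqP/setP => w; rewrite !inE; apply/negP => /andP[wx wy].
  case/eqP: ne; rewrite -!eq_porbit_mem in wx wy.
  by rewrite -(eqP wx) -(eqP wy).
- by apply/imsetP => -[x _ /setP/(_ x)]; rewrite inE porbit_id.
Qed.

Lemma iter_next (T : eqType) (s : seq T) (x y : T) :
  uniq s -> x \in s -> y \in s -> exists n, y = iter n (next s) x.
Proof.
move=> us xs; case: (rot_to xs) => i s' e.
have /= := cycle_next us; rewrite -(rot_cycle i) e /= => /fpathP[n].
rewrite -(mem_rot i) e inE => es /predU1P[->|]; first by exists 0.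
move=> ys; have : y \in rcons s' x by rewrite mem_rcons inE ys orbT.
by rewrite es => /trajectP[k _ ->]; exists k.+1; rewrite iterSr.
Qed.

Lemma porbit_cycle (T : finType) (s : {perm T}) (c : seq T) (x : T) :
  uniq c -> fcycle s c -> x \in c -> porbit s x = [set y in c].
Proof.
move=> uc sc xc; have sE y : y \in c -> s y = next c y.
  by move=> yc; apply/eqP; apply: next_cycle sc yc.
have itE n : iter n s x = iter n (next c) x /\ iter n s x \in c.
  elim: n => //= n [<- IH]; rewrite sE //; split=> //.
  by rewrite mem_next.
apply/setP => y; rewrite inE; apply/porbitP/idP => [[n ->]|yc].
  by rewrite permX; have [] := itE n.
have [n ->] := iter_next uc xc yc; exists n.
by rewrite permX; have [] := itE n.
Qed.

Lemma card_porbit_cycle (T : finType) (s : {perm T}) (c : seq T) (x : T) :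
  uniq c -> fcycle s c -> x \in c -> #|porbit s x| = size c.
Proof.
move=> uc sc xc; rewrite (porbit_cycle uc sc xc) cardsE.
exact/card_uniqP.
Qed.

(** The orbit length divides 4, and the last two hypotheses exclude 1 and 2. *)
Lemma card_porbit4 (T : finType) (s : {perm T}) (x : T) :
  iter 4 s x = x -> (forall y, s y != y) -> s (s x) != x -> #|porbit s x| = 4.
Proof.
move=> /= s4 s1 s2; have inj := @perm_inj _ s.
have d1 : x != s x by rewrite eq_sym s1.
have d2 : x != s (s x) by rewrite eq_sym.
have d3 : x != s (s (s x)).
  by apply/eqP => e3; have := s1 x; rewrite {1}e3 s4 eqxx.
apply: (@card_porbit_cycle _ _ [:: x; s x; s (s x); s (s (s x))]).
- by rewrite /= !inE !negb_or !(inj_eq inj) d1 d2 d3.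
- by rewrite /= s4 !eqxx.
- by rewrite inE eqxx.
Qed.

(** * Counting orbits when all but a few have four elements *)

Section CountPorbits.

Variables (T : finType) (s : {perm T}) (Cs : seq (seq T)).
Hypothesis uCs : uniq (flatten Cs).
Hypothesis cCs : all (fun c => fcycle s c && (4 <= size c)) Cs.
Hypothesis quadCs : forall x, x \notin flatten Cs -> #|porbit s x| = 4.

Let setof (c : seq T) : {set T} := [set y in c].

Let porbitCs c x : c \in Cs -> x \in c -> porbit s x = setof c /\ #|setof c| = size c.
Proof.
move=> cC xc; have /andP[sc _] := allP cCs c cC.
have uc : uniq c.
  elim: (Cs) uCs cC => //= d Ds IH; rewrite cat_uniq => /and3P[ud _ /IH uD].
  by rewrite inE => /predU1P[->|/uD].
by rewrite (porbit_cycle uc sc xc) /setof cardsE (card_uniqP uc).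
Qed.

Lemma porbits_ge4 f : f \in porbits s -> 4 <= #|f|.
Proof.
case/imsetP=> x _ ->; have [/flattenP[c cC xc]|/quadCs -> //] := boolP (x \in flatten Cs).
by have [-> ->] := porbitCs cC xc; have /andP[] := allP cCs c cC.
Qed.

Let uniq_setof : uniq (map setof Cs).
Proof.
elim: (Cs) uCs cCs => //= c Ds IH; rewrite cat_uniq => /and3P[_ dis uD].
case/andP=> /andP[_ c4] cD; rewrite IH // andbT; apply/mapP => -[d dD].
case: c c4 dis => [//|x c] _ dis /setP/(_ x); rewrite !inE eqxx /= => /esym xd.
case/hasP: dis; exists x; rewrite ?inE ?eqxx //.
by apply/flattenP; exists d.
Qed.

(** The orbits partition [T]: those in [Cs] account for [size (flatten Cs)] elements, every other
    one for four. *)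
Lemma card_porbits : 4 * #|porbits s| + size (flatten Cs) = #|T| + 4 * size Cs.
Proof.
have ne c : c \in Cs -> exists2 x, x \in c & porbit s x = setof c /\ #|setof c| = size c.
  move=> cC; have /andP[_] := allP cCs c cC.
  case: c cC => // x c cC _; exists x; first by rewrite inE eqxx.
  by apply: (@porbitCs (x :: c) x); rewrite ?inE ?eqxx.
pose A := [set f in map setof Cs].
have sA : porbits s :&: A = A.
  apply/setIidPr/subsetP => f; rewrite inE => /mapP[c /ne[x _ [<- _]] ->].
  exact: imset_f.
have cA : #|A| = size Cs by rewrite cardsE (card_uniqP uniq_setof) size_map.
have sumA : \sum_(f in A) #|f| = size (flatten Cs).
  have -> : \sum_(f in A) #|f| = \sum_(f in map setof Cs) #|f|.
    by apply: eq_bigl => f; rewrite inE.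
  rewrite -big_uniq //= big_map size_flatten sumnE big_map.
  by apply: eq_big_seq => c /ne[x _ [_ ->]].
have := card_partition (partition_porbits s); rewrite cardsT.
rewrite (big_setID A) /= sA sumA.
rewrite (eq_bigr (fun=> 4)) => [|f]; last first.
  rewrite inE => /andP[fA /imsetP[x _ ef]]; rewrite ef; apply: quadCs.
  apply: contra fA => /flattenP[c cC xc]; rewrite inE ef.
  by have [-> _] := porbitCs cC xc; apply: map_f.
rewrite sum_nat_const => ->; rewrite -(cardsID A (porbits s)) sA cA mulnDr.
by rewrite [_ * 4]mulnC -addnA addnC (addnC _ (size (flatten Cs))).
Qed.

End CountPorbits.

Lemma card_edges p : #|edges (complete_graph p)| = (p * p.-1)./2.
Proof.
rewrite -bin2 -[p in RHS]card_ord -card_draws; apply: eq_card => A.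
rewrite inE; apply/imsetP/cards2P => [[d _ ->]|[x [y [xy ->]]]].
  by exists (dart_tail d), (dart_head d); split=> //; apply: (valP d).
by exists (exist (fun d : 'I_p * 'I_p => d.1 != d.2) (x, y) xy).
Qed.

Lemma card_darts p : #|{: dart (complete_graph p)}| = p * p.-1.
Proof.
rewrite card_sig.
have -> : #|[pred x : 'I_p * 'I_p | x.1 != x.2]| = #|[predC [pred x : 'I_p * 'I_p | x.1 == x.2]]|.
  by apply: eq_card => x; rewrite !inE.
have := cardC [pred x : 'I_p * 'I_p | x.1 == x.2].
have -> : #|[pred x : 'I_p * 'I_p | x.1 == x.2]| = p.
  rewrite -[RHS]card_ord -(card_image (f := fun i : 'I_p => (i, i))) => [|i j []] //.
  apply: eq_card => -[i j]; rewrite !inE /=; apply/eqP/imageP => [->|[k _ [-> ->]]] //.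
  by exists j.
rewrite card_prod card_ord => e; apply: (@addnI p); rewrite e.
by case: p {e} => // p; rewrite mulnS.
Qed.

Definition face_step (r : nat -> seq nat) (d : nat * nat) : nat * nat :=
  (d.2, next (r d.2) d.1).

(** * The embedding of the complete graph defined by rotation lists *)

Section RotationSystem.

Variables (p : nat) (vs : seq nat) (r : nat -> seq nat) (Es : seq (seq (nat * nat))).
Hypotheses (p3 : 2 < p) (size_vs : size vs = p) (uvs : uniq vs).
Hypothesis ur : forall v, uniq (r v).
Hypothesis mr : forall u v, (u \in r v) = [&& u \in vs, v \in vs & u != v].
Hypothesis uEs : uniq (flatten Es).
Hypothesis fEs : all (fun E => fcycle (face_step r) E && (4 <= size E)) Es.
Hypothesis dEs : forall d, d \in flatten Es -> d.1 \in r d.2.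
Hypothesis quadEs : forall u v, u \in r v -> (u, v) \notin flatten Es ->
  iter 4 (face_step r) (u, v) = (u, v).

Let D := dart (complete_graph p).
(** Labels are looked up in [vs] because those of an odd map skip 1. *)
Let enc (d : D) : nat * nat := (nth 0 vs (dart_tail d), nth 0 vs (dart_head d)).

Let nth_inj (i j : 'I_p) : nth 0 vs i = nth 0 vs j -> i = j.
Proof.
move/eqP; rewrite nth_uniq ?size_vs ?ltn_ord // => /eqP e.
exact: val_inj.
Qed.

Let enc_inj : injective enc.
Proof.
move=> d e; case=> /nth_inj ht /nth_inj hh; apply: val_inj.
by rewrite [val d]surjective_pairing [val e]surjective_pairing; congr pair.
Qed.

Let encP (d : D) : (enc d).2 \in r (enc d).1 /\ (enc d).1 \in r (enc d).2.
Proof.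
have dn : (enc d).1 != (enc d).2.
  by apply/eqP => /nth_inj e; have := valP d; rewrite /= -/(dart_tail d) e eqxx.
by rewrite !mr !mem_nth ?size_vs ?ltn_ord //= eq_sym dn.
Qed.

Let enc_surj u v : u \in r v -> exists d, enc d = (u, v).
Proof.
rewrite mr => /and3P[uv vv ne].
have iu : index u vs < p by rewrite -size_vs index_mem.
have iv : index v vs < p by rewrite -size_vs index_mem.
have ned : Ordinal iu != Ordinal iv.
  apply: contra ne => /eqP/(congr1 val)/= e.
  by rewrite -(nth_index 0 uv) -(nth_index 0 vv) e.
exists (exist (fun d : 'I_p * 'I_p => d.1 != d.2) (Ordinal iu, Ordinal iv) ned).
by rewrite /enc /dart_tail /dart_head /= !nth_index.
Qed.

(** The default [d] is never returned: [enc_surj] provides the dart sought. *)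
Let rotate (d : D) : D :=
  odflt d [pick e | enc e == ((enc d).1, next (r (enc d).1) (enc d).2)].

Let sym u v : (u \in r v) = (v \in r u).
Proof. by rewrite !mr andbCA eq_sym. Qed.

Let rotateE d : enc (rotate d) = ((enc d).1, next (r (enc d).1) (enc d).2).
Proof.
rewrite /rotate; case: pickP => [e /eqP //|none].
have [e ee] : exists e, enc e = ((enc d).1, next (r (enc d).1) (enc d).2).
  by apply: enc_surj; rewrite sym mem_next; have [] := encP d.
by have := none e; rewrite ee eqxx.
Qed.

Let rotate_inj : injective rotate.
Proof.
move=> d e /(congr1 enc); rewrite !rotateE => ee; apply: enc_inj.
have e1 : (enc d).1 = (enc e).1 := congr1 fst ee.
have e2 : next (r (enc d).1) (enc d).2 = next (r (enc e).1) (enc e).2 := congr1 snd ee.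
rewrite [enc d]surjective_pairing [enc e]surjective_pairing e1; congr pair.
move: e2; rewrite e1 => /(congr1 (prev (r (enc e).1))).
by rewrite !prev_next.
Qed.

Let rot_perm : {perm D} := perm rotate_inj.

Let iter_rotate n d :
  enc (iter n rot_perm d) = ((enc d).1, iter n (next (r (enc d).1)) (enc d).2).
Proof.
by elim: n => /= [|n IH]; rewrite -?surjective_pairing // permE rotateE IH.
Qed.

Let rot_permP (d : D) :
  porbit rot_perm d = [set d' | dart_tail d' == dart_tail d].
Proof.
apply/setP => e; rewrite inE; apply/porbitP/eqP => [[n ->]|te].
  by rewrite permX; have [/nth_inj] := iter_rotate n d.
have [ed _] := encP d; have [ee _] := encP e.
have e1 : (enc e).1 = (enc d).1 by rewrite /enc te.
rewrite e1 in ee; have [n en] := iter_next (ur _) ed ee.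
exists n; apply: enc_inj; rewrite permX iter_rotate -en -e1.
exact: surjective_pairing.
Qed.

Let M : embedding (complete_graph p) := Embedding rot_permP.

Let face_permE d : enc (face_perm M d) = face_step r (enc d).
Proof. by rewrite /face_perm permM permE permE rotateE. Qed.

(** Each vertex has [p.-1 > 1] neighbours. This excludes faces of length 2 in [card_quad]. *)
Let next_neq u v : u \in r v -> next (r v) u != u.
Proof.
move=> uv; apply/eqP => nu.
have sub : {subset r v <= [:: u]}.
  move=> x xv; have [n ->] := iter_next (ur v) uv xv.
  by rewrite inE; elim: n => //= n /eqP ->; rewrite nu.
have := uniq_leq_size (ur v) sub; have vv : v \in vs by move: uv; rewrite mr => /and3P[].
suff /perm_size -> : perm_eq (r v) (rem v vs) by rewrite size_rem // size_vs /=; lia.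
apply: uniq_perm; rewrite ?rem_uniq // => x.
by rewrite mr vv mem_rem_uniq // inE andbC.
Qed.

Let lift_seq E : (forall d, d \in E -> d.1 \in r d.2) -> exists c, E = map enc c.
Proof.
elim: E => [|[u v] E IH] dE; first by exists [::].
have [|c ->] := IH; first by move=> d Ed; apply: dE; rewrite inE Ed orbT.
have [|d ed] := @enc_surj u v; first by apply: (dE (u, v)); rewrite inE eqxx.
by exists (d :: c); rewrite /= ed.
Qed.

Let lift_seqs (Fs : seq (seq (nat * nat))) :
  (forall d, d \in flatten Fs -> d.1 \in r d.2) -> exists Cs, Fs = map (map enc) Cs.
Proof.
elim: Fs => [|E Fs IH] dE; first by exists [::].
have [|Cs ->] := IH; first by move=> d Fd; apply: dE; rewrite mem_cat Fd orbT.
have [|c ->] := @lift_seq E; first by move=> d Ed; apply: dE; rewrite mem_cat Ed.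
by exists (c :: Cs).
Qed.

Let fcycle_enc c : fcycle (face_step r) (map enc c) = fcycle (face_perm M) c.
Proof.
case: c => // d c; rewrite /= -map_rcons path_map.
by apply: eq_path => x y /=; rewrite -face_permE inj_eq.
Qed.

Let card_quad d : enc d \notin flatten Es -> #|porbit (face_perm M) d| = 4.
Proof.
have [_] := encP d; rewrite [enc d]surjective_pairing => d12 nE.
have i4 := quadEs d12 nE; rewrite -surjective_pairing in i4.
have n2 := next_neq d12.
have itE n : enc (iter n (face_perm M) d) = iter n (face_step r) (enc d).
  by elim: n => //= n IH; rewrite face_permE IH.
apply: card_porbit4; first by apply: enc_inj; rewrite itE.
  move=> e; apply/eqP => /(congr1 enc); rewrite face_permE.
  have [_] := encP e; rewrite mr => /and3P[_ _ ne] ee.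
  by case/eqP: ne; rewrite -{1}ee.
apply: contra n2 => /eqP/(congr1 enc); rewrite !face_permE.
by move/(congr1 fst) => /= ->.
Qed.

Lemma rotation_system_embedding : exists M : embedding (complete_graph p),
  (forall f, f \in faces M -> 4 <= #|f|) /\
  4 * #|faces M| + size (flatten Es) = p * p.-1 + 4 * size Es.
Proof.
have [Cs eCs] := lift_seqs dEs.
have eF : flatten Es = map enc (flatten Cs) by rewrite eCs map_flatten.
have uCs : uniq (flatten Cs) by move: uEs; rewrite eF map_inj_uniq.
have cCs : all (fun c => fcycle (face_perm M) c && (4 <= size c)) Cs.
  move: fEs; rewrite eCs all_map; apply: sub_all => c /=.
  by rewrite fcycle_enc size_map.
have qCs x : x \notin flatten Cs -> #|porbit (face_perm M) x| = 4.
  by move=> nx; apply: card_quad; rewrite eF mem_map.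
exists M; split; first exact: porbits_ge4 uCs cCs qCs.
rewrite eF eCs !size_map -card_darts; exact: card_porbits uCs cCs qCs.
Qed.

End RotationSystem.

(** Lists are read cyclically at last, so that the quadrangles still open become faces. *)
Definition link (s : seq nat) (a b : nat) : bool :=
  infix [:: a; b] s || suffix [:: a] s && prefix [:: b] s.

Lemma next_link s a b : uniq s -> link s a b -> next s a = b.
Proof.
move=> us /orP[/infixP[p [q e]]|/andP[/suffixP[p e] pb]]; rewrite e in us *.
  by rewrite -(next_rot (size p)) // rot_size_cat /= eqxx.
rewrite -(next_rot (size p)) // rot_size_cat /=.
move: pb; rewrite {}e; case: p us => [_|c p _] /=; rewrite ?eqxx.
  by case/andP=> /eqP.
by case/andP=> /eqP.
Qed.

Lemma quad_face_step r u v w x : (forall v, uniq (r v)) ->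
  quad (fun v => link (r v)) u v w x -> iter 4 (face_step r) (u, v) = (u, v).
Proof.
move=> ur /and4P[c1 c2 c3 c4].
rewrite /= /face_step /= (next_link (ur v) c1) (next_link (ur w) c2).
by rewrite (next_link (ur x) c3) (next_link (ur u) c4).
Qed.

Lemma quadrangular_face_step P r (L : nat -> nat -> nat -> bool) X u v : (forall v, uniq (r v)) ->
  (forall v a b, L v a b -> link (r v) a b) -> quadrangular P r L X ->
  u \in r v -> (u, v) \notin X -> iter 4 (face_step r) (u, v) = (u, v).
Proof.
move=> ur sub qr /qr[->//|[w [x q]]|[i [s [t [_ o d]]]]] _.
  exact: (quad_face_step ur (quad_sub sub q)).
have q1 : quad (fun v => link (r v)) i.*2 s i.*2.+1 t.
  have /and5P[p0 q0 p1 q1 /andP[c0 c1]] := o.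
  apply/and4P; split; [exact: sub | | exact: sub | ].
    by rewrite /link q1 p1 orbT.
  by rewrite /link q0 p0 orbT.
have q2 := q1; rewrite quad_rot in q2; have q3 := q2; rewrite quad_rot in q3.
have q4 := q3; rewrite quad_rot in q4.
move: d; rewrite !inE => /or4P[] /eqP[-> ->].
- exact: quad_face_step q1.
- exact: quad_face_step q2.
- exact: quad_face_step q3.
- exact: quad_face_step q4.
Qed.

(** [p * p.-1] is the number of darts, twice the number of edges, so [e] is the total excess of the
    faces over length 4. *)
Definition near_quadrangular (p e : nat) : Prop :=
  exists M : embedding (complete_graph p),
    (forall f, f \in faces M -> 4 <= #|f|) /\ 4 * #|faces M| + e = p * p.-1.

Definition long_faces (Es : seq (seq (nat * nat))) : bool :=
  uniq (flatten Es) && all (fun E => 4 <= size E) Es.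

Lemma near_quadrangular_rotation p vs P r (L : nat -> nat -> nat -> bool) Es : 2 < p ->
  size vs = p -> uniq vs -> (forall v, uniq (r v)) ->
  (forall u v, (u \in r v) = [&& u \in vs, v \in vs & u != v]) ->
  (forall v a b, L v a b -> link (r v) a b) ->
  quadrangular P r L (flatten Es) -> traces r Es -> long_faces Es ->
  near_quadrangular p (size (flatten Es) - 4 * size Es).
Proof.
move=> p3 svs uvs ur mr sub qr tr /andP[uEs lEs].
have trE E d : E \in Es -> d \in E -> corner r d.2 d.1 (next E d).2 /\ d.2 = (next E d).1.
  move=> EE dE; have := next_cycle (allP tr _ EE) dE.
  by case/andP=> /eqP.
have [|||M [M4 MF]] := @rotation_system_embedding p vs r Es p3 svs uvs ur mr uEs.
- apply/allP => E EE; rewrite (allP lEs) // andbT.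
  have := allP tr _ EE; case: E {EE} => // d E; apply: sub_path => x y.
  case/andP=> /eqP xy c; rewrite /frel /= /face_step (@next_link _ _ y.2) //.
    by rewrite xy -surjective_pairing.
  by apply/orP; left.
- move=> d /flattenP[E EE dE]; have [c _] := trE E d EE dE.
  by apply: (mem_infix c); rewrite inE eqxx.
- by move=> u v; apply: quadrangular_face_step qr.
exists M; split=> //.
(* This makes the truncated subtraction in the conclusion exact. *)
have : 4 * size Es <= size (flatten Es).
  elim: (Es) lEs => //= E Fs IH /andP[E4 /IH]; rewrite size_cat; lia.
lia.
Qed.

Lemma even_state_iter h k Es r : 0 < h -> even_state h Es r ->
  exists r', even_state (h + 4 * k) Es r'.
Proof.
move=> h0 st; elim: k => [|k [r' st']]; first by exists r; rewrite addn0.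
rewrite mulnS (addnC 4) addnA; apply: even_state_step st'; lia.
Qed.

Lemma odd_state_iter h k Es r : 2 < h -> odd_state h Es r ->
  exists r', odd_state (h + 4 * k) Es r'.
Proof.
move=> h0 st; elim: k => [|k [r' st']]; first by exists r; rewrite addn0.
rewrite mulnS (addnC 4) addnA; apply: odd_state_step st'; lia.
Qed.

Lemma near_quadrangular_even tab Es k :
  2 < size tab -> check_even tab Es -> long_faces Es ->
  near_quadrangular (size tab + 8 * k) (size (flatten Es) - 4 * size Es).
Proof.
move=> t3 ok lE; have /and5P[ev _ _ _ _] := ok.
have [|r [ur mr pr qr tr]] := even_state_iter k _ (even_state_table ok); first by lia.
apply: (@near_quadrangular_rotation _ (iota 0 (size tab + 8 * k)) _ _ _ _ _ _ _ ur _ _ qr) => //.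
- by lia.
- by rewrite size_iota.
- exact: iota_uniq.
- by move=> u v; rewrite mr !mem_iota; lia.
- by move=> v a b c; apply/orP; left.
Qed.

(** Row 1 of the table belongs to no vertex, hence the predecessor of [size tab]. *)
Lemma near_quadrangular_odd tab Es k :
  5 < size tab -> check_odd tab Es -> long_faces Es ->
  near_quadrangular ((size tab).-1 + 8 * k) (size (flatten Es) - 4 * size Es).
Proof.
move=> t3 ok lE; have /and5P[/and3P[ev _ _] _ _ _ _] := ok.
have [|r [[ur mr tr] pr qr _]] := odd_state_iter k _ (odd_state_table ok); first by lia.
apply: (@near_quadrangular_rotation _ (0 :: iota 2 ((size tab).-2 + 8 * k)) _ _ _ _ _ _ _ ur _ _ qr) => //.
- by lia.
- by rewrite /= size_iota; lia.
- by rewrite /= iota_uniq mem_iota.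
- by move=> u v; rewrite mr !inE !mem_iota; lia.
- by move=> v a b /orP[c|/and3P[/eqP -> sa pb]]; apply/orP; [left | right; rewrite sa].
Qed.

(** * Initial embeddings *)

Definition table6 : seq (seq nat) :=
  [:: [:: 2; 1; 3; 4; 5];
      [:: 5; 0; 4; 3; 2];
      [:: 5; 4; 3; 0; 1];
      [:: 1; 0; 4; 2; 5];
      [:: 0; 1; 3; 5; 2];
      [:: 2; 3; 4; 1; 0]].

Definition table6_faces : seq (seq (nat * nat)) :=
  [:: [:: (5, 1); (1, 0); (0, 3); (3, 4); (4, 5)];
      [:: (1, 4); (4, 3); (3, 2); (2, 0); (0, 1)]].

Definition table10 : seq (seq nat) :=
  [:: [:: 5; 2; 3; 1; 7; 6; 9; 8; 4];
      [:: 4; 6; 0; 2; 3; 7; 8; 9; 5];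
      [:: 1; 3; 5; 9; 0; 4; 8; 6; 7];
      [:: 7; 2; 0; 9; 8; 6; 5; 4; 1];
      [:: 8; 9; 1; 0; 2; 5; 6; 7; 3];
      [:: 3; 4; 0; 1; 2; 9; 7; 6; 8];
      [:: 2; 5; 4; 3; 7; 1; 9; 8; 0];
      [:: 0; 6; 8; 9; 1; 4; 5; 3; 2];
      [:: 1; 9; 6; 7; 3; 4; 5; 2; 0];
      [:: 0; 8; 7; 6; 5; 4; 3; 2; 1]].

Definition table10_faces : seq (seq (nat * nat)) :=
  [:: [:: (9, 5); (5, 7); (7, 3); (3, 2); (2, 5); (5, 9); (9, 4); (4, 1); (1, 6); (6, 9)]].

Definition table12 : seq (seq nat) :=
  [:: [:: 5; 11; 6; 3; 9; 8; 4; 7; 2; 1; 10];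
      [:: 10; 4; 9; 3; 8; 2; 7; 6; 11; 0; 5];
      [:: 4; 6; 8; 10; 3; 9; 5; 0; 1; 11; 7];
      [:: 7; 6; 1; 0; 10; 9; 5; 11; 2; 8; 4];
      [:: 11; 10; 8; 0; 5; 1; 6; 7; 2; 3; 9];
      [:: 9; 4; 8; 10; 3; 6; 0; 1; 2; 7; 11];
      [:: 11; 5; 9; 2; 7; 8; 3; 4; 10; 0; 1];
      [:: 1; 0; 8; 6; 4; 3; 2; 5; 9; 10; 11];
      [:: 11; 1; 6; 3; 10; 7; 4; 2; 9; 5; 0];
      [:: 0; 1; 5; 4; 10; 8; 6; 3; 7; 2; 11];
      [:: 7; 3; 6; 1; 0; 11; 5; 9; 8; 2; 4];
      [:: 4; 5; 2; 8; 9; 3; 10; 1; 0; 6; 7]].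

Definition table12_faces : seq (seq (nat * nat)) :=
  [:: [:: (8, 3); (3, 4); (4, 9); (9, 10); (10, 8); (8, 7); (7, 6); (6, 8)]].

Definition table5 : seq (seq nat) :=
  [:: [:: 5; 2; 3; 4];
      [::];
      [:: 0; 4; 3; 5];
      [:: 5; 4; 2; 0];
      [:: 0; 2; 5; 3];
      [:: 3; 2; 4; 0]].

Definition table7 : seq (seq nat) :=
  [:: [:: 7; 5; 4; 3; 2; 6];
      [::];
      [:: 7; 4; 3; 6; 5; 0];
      [:: 0; 6; 4; 5; 2; 7];
      [:: 3; 5; 7; 2; 6; 0];
      [:: 0; 4; 2; 7; 6; 3];
      [:: 0; 3; 4; 7; 2; 5];
      [:: 5; 6; 2; 3; 4; 0]].

Definition table7_faces : seq (seq (nat * nat)) :=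
  [:: [:: (6, 3); (3, 4); (4, 5); (5, 2); (2, 0); (0, 6)]].

Definition table9 : seq (seq nat) :=
  [:: [:: 9; 3; 2; 5; 7; 6; 4; 8];
      [::];
      [:: 7; 6; 9; 0; 8; 3; 4; 5];
      [:: 5; 2; 9; 6; 4; 8; 0; 7];
      [:: 2; 5; 3; 9; 0; 8; 6; 7];
      [:: 7; 6; 0; 9; 8; 4; 3; 2];
      [:: 8; 0; 9; 3; 2; 4; 7; 5];
      [:: 5; 4; 2; 3; 9; 0; 6; 8];
      [:: 0; 9; 6; 7; 4; 2; 3; 5];
      [:: 5; 2; 3; 8; 4; 6; 7; 0]].

Definition table9_faces : seq (seq (nat * nat)) :=
  [:: [:: (4, 8); (8, 2); (2, 3); (3, 9); (9, 8); (8, 6); (6, 0); (0, 4)]].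

Definition table11 : seq (seq nat) :=
  [:: [:: 11; 2; 9; 3; 4; 6; 8; 7; 5; 10];
      [::];
      [:: 10; 0; 6; 5; 7; 3; 4; 9; 8; 11];
      [:: 11; 4; 8; 9; 0; 6; 7; 2; 5; 10];
      [:: 10; 5; 2; 7; 8; 0; 9; 11; 3; 6];
      [:: 6; 0; 2; 8; 9; 4; 3; 7; 11; 10];
      [:: 3; 9; 0; 8; 2; 5; 4; 11; 7; 10];
      [:: 10; 9; 8; 11; 6; 5; 2; 0; 4; 3];
      [:: 3; 11; 5; 6; 4; 0; 9; 7; 10; 2];
      [:: 2; 5; 11; 8; 6; 0; 10; 7; 4; 3];
      [:: 0; 7; 6; 11; 8; 9; 2; 3; 4; 5];
      [:: 5; 6; 3; 2; 10; 7; 9; 8; 4; 0]].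

Definition table11_faces : seq (seq (nat * nat)) :=
  [:: [:: (0, 2); (2, 6); (6, 5); (5, 0); (0, 10); (10, 7); (7, 9); (9, 4); (4, 11); (11, 0)]].

Definition table4 : seq (seq nat) :=
  [:: [:: 1; 3; 2]; [:: 3; 2; 0]; [:: 0; 1; 3]; [:: 2; 0; 1]].

Definition table4_faces : seq (seq (nat * nat)) :=
  [:: [:: (3, 0); (0, 2); (2, 1); (1, 0); (0, 3); (3, 1); (1, 2); (2, 3)]].

(** The recursion never starts from order 4, as order 12 has its own table; so no pairs are kept and
    the lists are read cyclically from the outset. *)
Lemma near_quadrangular4 : near_quadrangular 4 4.
Proof.
have okv : check_vertices table4 (fun u v => u != v) by vm_compute.
have mt := mem_table _ _ okv.
apply: (@near_quadrangular_rotation 4 (iota 0 4) xpred0 (nth [::] table4)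
  (fun v => link (nth [::] table4 v)) table4_faces) => //.
- by move=> v; apply: uniq_table okv.
- by move=> u v; rewrite mt !mem_iota.
- by apply: quadrangular_table; vm_compute.
Qed.

(* The unique [0 <= e < 8] with [p (p - 5) + e] divisible by 8. *)
Definition excess (p : nat) : nat := nth 0 [:: 0; 4; 6; 6; 4; 0; 2; 2] (p %% 8).

Lemma near_quadrangular_complete p : 4 <= p -> near_quadrangular p (excess p).
Proof.
move=> p4; have [->|np4] := eqVneq p 4; first exact: near_quadrangular4.
(* Residues are counted from 5, since the recursion starts from the orders 5 to 12. *)
pose q := (p - 5) %/ 8.
have : p = 5 + (p - 5) %% 8 + 8 * q by rewrite /q; lia.
have : (p - 5) %% 8 < 8 by rewrite ltn_mod.
rewrite /excess; move: (_ %% 8) q => s q s8 ->.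
rewrite -(modnDmr _ (8 * q)) modnMr addn0.
case: s s8 => [|[|[|[|[|[|[|[|s]]]]]]]] // _.
- exact: (@near_quadrangular_odd table5 [::]).
- exact: (@near_quadrangular_even table6 table6_faces).
- exact: (@near_quadrangular_odd table7 table7_faces).
- exact: (@near_quadrangular_even table8 [::]).
- exact: (@near_quadrangular_odd table9 table9_faces).
- exact: (@near_quadrangular_even table10 table10_faces).
- exact: (@near_quadrangular_odd table11 table11_faces).
- exact: (@near_quadrangular_even table12 table12_faces).
Qed.

(** * Arithmetic of the genus and the lower bound *)

Lemma genus_exists p : exists h, 8 * h + 5 * p = p * p + excess p + 8.
Proof.
pose q := p %/ 8; have : p = p %% 8 + 8 * q by rewrite /q addnC mulnC -divn_eq.
rewrite /excess; have : p %% 8 < 8 by rewrite ltn_mod.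
move: (p %% 8) q => s q s8 ->; have qq : q <= q * q by case: (q) => // n; rewrite leq_pmulr.
(* Ensures that subtracting [5 * q] in the witness does not truncate. *)
have q5 : 5 * q <= 8 * (q * q) by lia.
(* Obtained by expanding at [p = s + 8 * q]; the listed constants are
   [(s * (s - 5) + excess s) / 8 + 1]. *)
exists (8 * (q * q) + 2 * (q * s) - 5 * q + nth 0 [:: 1; 1; 1; 1; 1; 1; 2; 3] s).
by case: s s8 => [|[|[|[|[|[|[|[|s]]]]]]]] // _ /=; lia.
Qed.

Lemma faces_le p (M : embedding (complete_graph p)) :
  (forall f, f \in faces M -> 4 <= #|f|) -> 4 * #|faces M| <= p * p.-1.
Proof.
move=> M4; rewrite -card_darts -cardsT (card_partition (partition_porbits (face_perm M))).
by rewrite mulnC -sum_nat_const; apply: leq_sum.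
Qed.

Lemma complete_connected p : 0 < p -> connected_graph (complete_graph p).
Proof.
move=> p0; split; first by rewrite card_ord.
move=> x y; have [->|xy] := eqVneq x y; first exact: connect0.
exact: connect1.
Qed.

(** Euler's formula times four, with edges counted by darts to avoid halving. *)
Lemma has_genusE p (M : embedding (complete_graph p)) h : 0 < p ->
  has_genus M h <-> 4 * #|faces M| + 8 * h + 4 * p = 2 * (p * p.-1) + 8.
Proof.
move=> p0; rewrite /has_genus card_edges card_ord.
have ev : p * p.-1 = (p * p.-1)./2.*2.
  by rewrite halfK oddM; case: p p0 {M} => //= p _; rewrite andNb subn0.
by rewrite [in X in _ <-> X]ev; move: #|_| (_./2) => a b; split; lia.
Qed.

Theorem theorem1 (p : nat) (hp : (4 <= p)%N) :
  exists h : nat,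
    is_n_genus 4 (complete_graph p) h /\
    (h%:Z = Num.ceil (p%:R * (p%:R - 5) / 8 : rat) + 1)%R.
Proof.
have e8 : excess p < 8.
  rewrite /excess; have : p %% 8 < 8 by rewrite ltn_mod.
  by move: (p %% 8) => [|[|[|[|[|[|[|[|s]]]]]]]].
have [h hE] := genus_exists p; exists h; split.
  have p0 : 0 < p by lia.
  have pp : p * p.-1 + p = p * p by case: p {hp hE e8} p0 => // p _; rewrite mulnS addnC.
  split=> [|h' [_ [M' [gM' M'4]]]].
    split; first exact: complete_connected.
    have [M [M4 MF]] := near_quadrangular_complete hp.
    exists M; split=> //; apply/has_genusE => //; lia.
  (* Euler's formula and [faces_le] give [8 * h' >= p * (p - 5) + 8], while [8 * h] exceeds this
     bound by [excess p < 8]; hence [h <= h']. *)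
  move/has_genusE: gM' => /(_ p0); have := faces_le M'4.
  by move: #|_| => F; lia.
have hR : (8 * h%:R + 5 * p%:R = p%:R * p%:R + (excess p)%:R + 8 :> rat)%R.
  by rewrite -!GRing.natrM -!GRing.natrD hE.
have eR : ((excess p)%:R < 8 :> rat)%R by rewrite Num.Theory.ltr_nat.
have e0 : (0 <= (excess p)%:R :> rat)%R by rewrite Num.Theory.ler0n.
(* [p * (p - 5) / 8] equals [h - 1 - excess p / 8], with [excess p / 8] in [[0, 1)], so its ceiling
   is [h - 1]. *)
rewrite (@Num.Theory.ceil_def _ _ (h%:Z - 1)%R) ?GRing.subrK //.
rewrite !GRing.rmorphB /= -!pmulrn.
move: hR eR e0; move: (h%:R)%R (p%:R)%R ((excess p)%:R)%R => a b c hR eR e0.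
apply/andP; split; nra.
Qed.
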